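(* Let $\omega\in\{+1,-1\}$, let $p\ge5$ be an odd integer, and let $s<0$. There is a constant $c>0$, depending only on $s$, such that for every $\rho>0$ and every $\delta>0$ there exist smooth solutions $u_1,u_2$ of $$-iu_t+u_{xx}=\omega|u|^{p-1}u$$ on $[0,\delta]\times\mathbb{T}$ such that $u_1(0)-u_2(0)$ is equal to a constant (independent of $x$) of magnitude at most $\delta$, $$\|u_1(0)\|_{H^s(\mathbb{T})}+\|u_2(0)\|_{H^s(\mathbb{T})}\le\rho,$$ and $$\sup_{0\le t\le\delta}\bigl|\widehat{u_1(t)}(0)-\widehat{u_2(t)}(0)\bigr|\ge c\rho .$$
   Context: $\mathbb{T}=\mathbb{R}/2\pi\mathbb{Z}$. Functions $u(t,x)$ are complex valued, and $u(t)$ denotes the function $x\mapsto u(t,x)$ on $\mathbb{T}$. Fourier coefficients are $\hat f(n)=\frac1{2\pi}\int_{\mathbb{T}}f(x)e^{-inx}\,dx$ for $n\in\mathbb{Z}$, and $\|f\|_{H^s(\mathbb{T})}=\bigl(\sum_{n\in\mathbb{Z}}(1+|n|)^{2s}|\hat f(n)|^2\bigr)^{1/2}$. *)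

(* Defs.v *)
From Stdlib Require Import Reals ZArith.
From Coquelicot Require Import Coquelicot.
Open Scope R_scope.

(* Functions on the torus are 2 PI-periodic functions on R. *)

Definition fourier_coeff (f : R -> C) (n : Z) : C :=
  scal (V := C_R_NormedModule) (/ (2 * PI))
    (RInt (V := C_R_CompleteNormedModule)
       (fun x => (f x * (cos (IZR n * x), - sin (IZR n * x))%R)%C) 0 (2 * PI)).

(* The sum over Z of a nonnegative family, as the limit in Rbar of the
   nondecreasing symmetric partial sums over -N <= n <= N. *)
Definition sum_Z (a : Z -> R) : Rbar :=
  Lim_seq (fun N => sum_n (fun k => a (Z.of_nat k - Z.of_nat N)%Z) (2 * N)).

(* The value at m_infty is never used: it is applied to nonnegative sums. *)
Definition Rbar_sqrt (x : Rbar) : Rbar :=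
  match x with
  | Finite r => Finite (sqrt r)
  | p_infty => p_infty
  | m_infty => m_infty
  end.

(* Valued in Rbar, so that a divergent sum gives p_infty. *)
Definition Hs_norm (s : R) (f : R -> C) : Rbar :=
  Rbar_sqrt (sum_Z (fun n =>
    Rpower (1 + Rabs (IZR n)) (2 * s) * (Cmod (fourier_coeff f n)) ^ 2)).

(* The derivative of f at x relative to the set A: one-sided when A is an
   interval and x one of its end points. *)
Definition is_derive_within (A : R -> Prop) (f : R -> C) (x : R) (l : C) : Prop :=
  filterdiff (K := R_AbsRing) (U := R_NormedModule) (V := C_R_NormedModule)
    f (within A (locally x)) (fun y => scal y l).

(* u is C^infinity on [0, delta] x R, up to the boundary: D j k is the partial
   derivative of u of order j in t and k in x, these derivatives commute, and
   all of them are jointly continuous. *)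
Definition smooth_with_partials (delta : R) (u : R -> R -> C)
    (D : nat -> nat -> R -> R -> C) : Prop :=
  (forall t x, 0 <= t <= delta -> D 0%nat 0%nat t x = u t x) /\
  (forall j k t x, 0 <= t <= delta ->
     is_derive_within (fun t' => 0 <= t' <= delta)
       (fun t' => D j k t' x) t (D (S j) k t x)) /\
  (forall j k t x, 0 <= t <= delta ->
     is_derive (K := R_AbsRing) (V := C_R_NormedModule)
       (fun x' => D j k t x') x (D j (S k) t x)) /\
  (forall j k,
     continuous_on (T := prod_UniformSpace R_UniformSpace R_UniformSpace)
       (U := C_R_NormedModule)
       (fun q => 0 <= fst q <= delta) (fun q => D j k (fst q) (snd q))).

Definition smooth_NLS_solution (omega : R) (p : nat) (delta : R)
    (u : R -> R -> C) : Prop :=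
  (forall t x, 0 <= t <= delta -> u t (x + 2 * PI) = u t x) /\
  exists D : nat -> nat -> R -> R -> C,
    smooth_with_partials delta u D /\
    forall t x, 0 <= t <= delta ->
      (- Ci * D 1%nat 0%nat t x + D 0%nat 2%nat t x)%C =
      (RtoC omega * RtoC (Cmod (u t x) ^ (p - 1)) * u t x)%C.

(* Main.v *)
Require Import Defs.
From Stdlib Require Import Reals ZArith.
From Coquelicot Require Import Coquelicot.
From Stdlib Require Import Lra Lia Ranalysis5 PSeries_reg List.
Import ListNotations.
Open Scope R_scope.

(** With [p = 2 q + 1], take the initial data [a + b e^{iNx}] for a fixed [b] and
two nearby values of [a].  As [N] tends to infinity, dispersion averages out
every interaction except the resonant ones, so that for [0 <= t <= delta] the solution
is uniformly close to [a e^{i alpha t} + b e^{i beta t} e^{iNx}], where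
[alpha = omega g (a^2, b)] and [a g (a^2, b)] is the constant Laurent coefficient
of [|a + b E|^(2 q) (a + b E)].  Because [q >= 2], [g] contains a monomial
[a^2 b^(2 q - 2)], so choosing [b] large makes the two zero modes rotate out of
phase within time [delta]; since [s < 0], choosing [N] afterwards makes
[b N^s] small.

Existence up to time [delta] follows from Picard iteration started at the
approximate solution: the first increment is [O(N^-2)] because it only contains
non-resonant Duhamel integrals, and the later ones are controlled by Gronwall's
inequality, so that the iterates never leave a fixed ball.  All iterates are
trigonometric polynomials in [x] with continuous coefficients in [t], which is
why finite sums suffice.  *)

(** No smallness is available: [b] is large, and for [omega = -1] large data may blow up, so the
    lifetime has to come from closeness to an explicit trajectory. This works because all constants
    but one are fixed before [N]. The norm weights the mode [k N] by [exp |k|], not by a function of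
    [k N]; hence the size of the ansatz and the Lipschitz constant [L] of the nonlinearity do not
    see [N]. Only the non-resonant Duhamel integral does, through detunings that grow like [N^2].
    Derivatives in [x] cost powers of [N], which is harmless because they only serve to prove
    smoothness once [N] is fixed.

    The exponent matters in the rotation speed: for [q = 1] one has [g (A, b) = A + 2 b^2], so the
    speeds for two values of [A] differ by an amount free of [b]. From [q = 2] on the difference is
    amplified by [b], and data that are arbitrarily close can be separated within any given time.

    The limit is built on the open interval [|t| < T] with [T > delta], so that no one-sided
    derivatives occur before the very end. *)

Notation CR := C_R_NormedModule.

(** * Calculus of complex-valued functions *)

Definition is_derive_C (f : R -> C) (x : R) (l : C) : Prop :=
  is_derive (K := R_AbsRing) (V := CR) f x l.

Definition continuous_C {T : UniformSpace} (f : T -> C) (x : T) : Prop :=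
  continuous (U := CR) f x.

Lemma is_derive_C_pair (f : R -> C) (x : R) (l : C) :
  is_derive_C f x l <->
  is_derive (fun y => fst (f y)) x (fst l) /\ is_derive (fun y => snd (f y)) x (snd l).
Proof.
  split.
  - intros H; split.
    + apply (filterdiff_comp' (U := R_NormedModule) (V := CR) (W := R_NormedModule) f
        (fun z : C => fst z) x (fun y => scal y l) (fun z : C => fst z) H).
      apply filterdiff_linear, is_linear_fst.
    + apply (filterdiff_comp' (U := R_NormedModule) (V := CR) (W := R_NormedModule) f
        (fun z : C => snd z) x (fun y => scal y l) (fun z : C => snd z) H).
      apply filterdiff_linear, is_linear_snd.
  - intros [H1 H2].
    unfold is_derive.
    apply filterdiff_ext with (fun y => (fst (f y), snd (f y))).
    { intros y; now destruct (f y). }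
    pose proof (filterdiff_comp'_2 (U := R_NormedModule) (V := R_NormedModule) (W := CR)
      (fun y => fst (f y)) (fun y => snd (f y)) (fun a b => (a, b)) x _ _
      (fun a b => (a, b)) H1 H2) as H.
    assert (H3 : filterdiff (K := R_AbsRing) (U := prod_NormedModule _ R_NormedModule
      R_NormedModule) (V := CR)
      (fun t : R * R => (fst t, snd t)) (locally (fst (f x), snd (f x))) (fun t => (fst t, snd t))).
    { apply filterdiff_ext_lin with (fun t => t).
      - apply filterdiff_ext with (fun t => t).
        + now intros [].
        + apply filterdiff_id.
      - now intros []. }
    specialize (H H3).
    eapply filterdiff_ext_lin; [exact H|].
    intros y; now destruct l.
Qed.

Lemma is_derive_C_mult (f g : R -> C) (x : R) (lf lg : C) :
  is_derive_C f x lf -> is_derive_C g x lg ->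
  is_derive_C (fun y => (f y * g y)%C) x (lf * g x + f x * lg)%C.
Proof.
  rewrite !is_derive_C_pair; intros [f1 f2] [g1 g2]; split.
  - evar_last.
    + apply (is_derive_minus (fun y => fst (f y) * fst (g y)) (fun y => snd (f y) * snd (g y)));
      apply (is_derive_mult (K := R_AbsRing)); try eassumption; exact Rmult_comm.
    + cbn; ring.
  - evar_last.
    + apply (is_derive_plus (fun y => fst (f y) * snd (g y)) (fun y => snd (f y) * fst (g y)));
      apply (is_derive_mult (K := R_AbsRing)); try eassumption; exact Rmult_comm.
    + cbn; ring.
Qed.

Lemma is_derive_C_plus (f g : R -> C) (x : R) (lf lg : C) :
  is_derive_C f x lf -> is_derive_C g x lg ->
  is_derive_C (fun y => (f y + g y)%C) x (lf + lg)%C.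
Proof. exact (is_derive_plus (K := R_AbsRing) (V := CR) f g x lf lg). Qed.

Lemma is_derive_C_const (c : C) (x : R) : is_derive_C (fun _ => c) x 0%C.
Proof. exact (is_derive_const (K := R_AbsRing) (V := CR) c x). Qed.

Lemma is_derive_C_conj (f : R -> C) (x : R) (l : C) :
  is_derive_C f x l -> is_derive_C (fun y => Cconj (f y)) x (Cconj l).
Proof.
  rewrite !is_derive_C_pair; intros [f1 f2]; cbn; split; auto.
  now apply (is_derive_opp (fun y => snd (f y))).
Qed.

Lemma is_derive_C_ext (f g : R -> C) (x : R) (l : C) :
  (forall y, f y = g y) -> is_derive_C f x l -> is_derive_C g x l.
Proof. intros H; now apply is_derive_ext. Qed.

Lemma is_derive_C_unique (f : R -> C) (x : R) (l l' : C) :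
  is_derive_C f x l -> is_derive_C f x l' -> l = l'.
Proof.
  rewrite !is_derive_C_pair; intros [f1 f2] [g1 g2].
  apply injective_projections.
  - now rewrite <- (is_derive_unique _ _ _ f1), <- (is_derive_unique _ _ _ g1).
  - now rewrite <- (is_derive_unique _ _ _ f2), <- (is_derive_unique _ _ _ g2).
Qed.

Definition cis (y : R) : C := (cos y, sin y).

Lemma cis_plus (x y : R) : cis (x + y) = (cis x * cis y)%C.
Proof.
  unfold cis; apply injective_projections; cbn;
  [rewrite cos_plus | rewrite sin_plus]; ring.
Qed.

Lemma cis_0 : cis 0 = 1%C.
Proof. unfold cis; now rewrite cos_0, sin_0. Qed.

Lemma cis_opp (y : R) : cis (- y) = Cconj (cis y).
Proof. unfold cis, Cconj; cbn; now rewrite cos_neg, sin_neg. Qed.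

Lemma Cmod_cis (y : R) : Cmod (cis y) = 1.
Proof.
  unfold Cmod, cis; cbn [fst snd].
  rewrite <- sqrt_1; f_equal.
  pose proof (sin2_cos2 y) as H; unfold Rsqr in H; lra.
Qed.

Lemma is_derive_cis (m y : R) : is_derive_C (fun y => cis (m * y)) y (RtoC m * Ci * cis (m * y))%C.
Proof.
  apply is_derive_C_pair; cbn; split; auto_derive; auto; ring.
Qed.

Section Continuity.
Context {T : UniformSpace}.

Lemma continuous_C_pair (f : T -> C) (x : T) :
  continuous_C f x <->
  continuous (fun y => fst (f y)) x /\ continuous (fun y => snd (f y)) x.
Proof.
  split.
  - intros H; split.
    + apply (continuous_comp (V := CR) f (fun z : C => fst z)); [exact H | apply continuous_fst].
    + apply (continuous_comp (V := CR) f (fun z : C => snd z)); [exact H | apply continuous_snd].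
  - intros [H1 H2].
    apply (continuous_ext (U := CR) (fun y => (fst (f y), snd (f y)))).
    { intros y; now destruct (f y). }
    unfold continuous.
    pose proof (filterlim_pair (fun y => fst (f y)) (fun y => snd (f y)) (F := locally x) H1 H2)
      as H.
    intros P [eps HP].
    apply H.
    exists (ball (fst (f x)) eps) (ball (snd (f x)) eps); try apply locally_ball.
    intros u v Hu Hv; apply HP; split; assumption.
Qed.

Lemma continuous_C_plus (f g : T -> C) (x : T) :
  continuous_C f x -> continuous_C g x ->
  continuous_C (fun y => (f y + g y)%C) x.
Proof. exact (continuous_plus (K := R_AbsRing) (V := CR) f g x). Qed.

Lemma continuous_C_mult (f g : T -> C) (x : T) :
  continuous_C f x -> continuous_C g x ->
  continuous_C (fun y => (f y * g y)%C) x.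
Proof.
  rewrite !continuous_C_pair; intros [f1 f2] [g1 g2]; cbn; split.
  - apply (continuous_minus (fun y => fst (f y) * fst (g y)) (fun y => snd (f y) * snd (g y)));
    now apply (continuous_mult (K := R_AbsRing)).
  - apply (continuous_plus (fun y => fst (f y) * snd (g y)) (fun y => snd (f y) * fst (g y)));
    now apply (continuous_mult (K := R_AbsRing)).
Qed.

Lemma continuous_C_conj (f : T -> C) (x : T) :
  continuous_C f x -> continuous_C (fun y => Cconj (f y)) x.
Proof.
  rewrite !continuous_C_pair; intros [f1 f2]; cbn; split; auto.
  now apply (continuous_opp (fun y => snd (f y))).
Qed.

Lemma continuous_cis (f : T -> R) (x : T) :
  continuous f x -> continuous_C (fun y => cis (f y)) x.
Proof.
  intros H; apply continuous_C_pair; cbn; split.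
  - apply continuous_comp; [exact H | apply continuous_cos].
  - apply continuous_comp; [exact H | apply continuous_sin].
Qed.

Lemma continuous_Cmod (f : T -> C) (x : T) :
  continuous_C f x -> continuous (fun y => Cmod (f y)) x.
Proof.
  intros H; apply (continuous_comp (V := CR) f Cmod); [exact H|].
  eapply continuous_ext; [intros; symmetry; apply Cmod_norm|].
  apply filterlim_norm.
Qed.
End Continuity.

Lemma is_derive_C_continuous (f : R -> C) (x : R) (l : C) :
  is_derive_C f x l -> continuous_C f x.
Proof. intros H; apply ex_derive_continuous; now exists l. Qed.

(** * Uniform limits *)

(** The geometric rate is built in: it is the rate of the Picard iterates, and it is stable under
    sums and products by arithmetic on [K] alone. *)
Definition unif_cv {T : Type} (S : T -> Prop) (fn : nat -> T -> C) (f : T -> C) : Prop :=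
  exists K : R, forall n x, S x -> Cmod (fn n x - f x)%C <= K * (/ 2) ^ n.

Definition unif_bounded {T : Type} (S : T -> Prop) (f : T -> C) : Prop :=
  exists M : R, forall x, S x -> Cmod (f x) <= M.

Lemma pow_half_pos (n : nat) : 0 < (/ 2) ^ n.
Proof. apply pow_lt; lra. Qed.

Lemma pow_half_le1 (n : nat) : (/ 2) ^ n <= 1.
Proof. rewrite <- (pow1 n); apply pow_incr; lra. Qed.

Lemma pow_half_small (K eps : R) : 0 < eps ->
  exists N : nat, forall n, (N <= n)%nat -> K * (/ 2) ^ n < eps.
Proof.
  intros He.
  assert (HK : 0 < Rabs K + 1) by (pose proof (Rabs_pos K); lra).
  destruct (pow_lt_1_zero (/ 2)) with (y := eps / (Rabs K + 1)) as [N HN].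
  { rewrite Rabs_pos_eq; lra. }
  { now apply Rdiv_lt_0_compat. }
  exists N; intros n Hn.
  specialize (HN n Hn).
  pose proof (pow_half_pos n) as Hp.
  rewrite Rabs_pos_eq in HN by lra.
  apply Rle_lt_trans with ((Rabs K + 1) * (/ 2) ^ n).
  { apply Rmult_le_compat_r; [lra|]. pose proof (Rle_abs K); lra. }
  apply Rmult_lt_compat_l with (r := Rabs K + 1) in HN; [|lra].
  replace ((Rabs K + 1) * (eps / (Rabs K + 1))) with eps in HN by (field; lra).
  exact HN.
Qed.

Section Uniform.
Context {T : Type} (S : T -> Prop).

Lemma unif_cv_const (f : T -> C) : unif_cv S (fun _ => f) f.
Proof.
  exists 0; intros n x _.
  replace (f x - f x)%C with (RtoC 0) by ring.
  rewrite Cmod_0; lra.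
Qed.

Lemma unif_cv_plus fn f gn g : unif_cv S fn f -> unif_cv S gn g ->
  unif_cv S (fun n x => fn n x + gn n x)%C (fun x => f x + g x)%C.
Proof.
  intros [K HK] [L HL]; exists (K + L); intros n x Hx.
  replace (fn n x + gn n x - (f x + g x))%C
    with ((fn n x - f x) + (gn n x - g x))%C by ring.
  eapply Rle_trans; [apply Cmod_triangle|].
  specialize (HK n x Hx); specialize (HL n x Hx); lra.
Qed.

Lemma unif_cv_conj fn f : unif_cv S fn f ->
  unif_cv S (fun n x => Cconj (fn n x)) (fun x => Cconj (f x)).
Proof.
  intros [K HK]; exists K; intros n x Hx.
  rewrite <- Cminus_conj, Cmod_conj; auto.
Qed.

(** Only the limits need bounds: [gn n] stays within [|L|] of [g], since the rate never exceeds
    1. *)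
Lemma unif_cv_mult fn f gn g : unif_bounded S f -> unif_bounded S g -> unif_cv S fn f ->
  unif_cv S gn g ->
  unif_cv S (fun n x => fn n x * gn n x)%C (fun x => f x * g x)%C.
Proof.
  intros [M HM] [P HP] [K HK] [L HL].
  exists (Rabs K * (Rabs P + Rabs L) + Rabs M * Rabs L); intros n x Hx.
  specialize (HM x Hx); specialize (HP x Hx); specialize (HK n x Hx); specialize (HL n x Hx).
  pose proof (pow_half_pos n) as H0; pose proof (pow_half_le1 n) as H1.
  replace (fn n x * gn n x - f x * g x)%C
    with ((fn n x - f x) * (g x + (gn n x - g x)) + f x * (gn n x - g x))%C by ring.
  eapply Rle_trans; [apply Cmod_triangle|].
  rewrite !Cmod_mult.
  pose proof (Cmod_triangle (g x) (gn n x - g x)%C) as Ht.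
  pose proof (Cmod_ge_0 (f x)); pose proof (Cmod_ge_0 (g x));
  pose proof (Cmod_ge_0 (fn n x - f x)%C); pose proof (Cmod_ge_0 (gn n x - g x)%C).
  pose proof (Rle_abs K); pose proof (Rle_abs L); pose proof (Rle_abs M); pose proof (Rle_abs P).
  set (h := (/ 2) ^ n) in *.
  assert (A1 : Cmod (fn n x - f x)%C <= Rabs K * h) by nra.
  assert (A2 : Cmod (gn n x - g x)%C <= Rabs L * h) by nra.
  assert (A3 : Cmod (g x + (gn n x - g x))%C <= Rabs P + Rabs L) by (pose proof (Rabs_pos L); nra).
  apply Rle_trans with (Rabs K * h * (Rabs P + Rabs L) + Rabs M * (Rabs L * h)); [|right; ring].
  apply Rplus_le_compat; apply Rmult_le_compat; try apply Cmod_ge_0; lra.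
Qed.

Lemma unif_bounded_const (c : C) : unif_bounded S (fun _ => c).
Proof. exists (Cmod c); intros; lra. Qed.

Lemma unif_bounded_plus f g : unif_bounded S f -> unif_bounded S g ->
  unif_bounded S (fun x => f x + g x)%C.
Proof.
  intros [M HM] [P HP]; exists (M + P); intros x Hx.
  eapply Rle_trans; [apply Cmod_triangle|]; specialize (HM x Hx); specialize (HP x Hx); lra.
Qed.

Lemma unif_bounded_mult f g : unif_bounded S f -> unif_bounded S g ->
  unif_bounded S (fun x => f x * g x)%C.
Proof.
  intros [M HM] [P HP]; exists (M * P); intros x Hx.
  rewrite Cmod_mult; apply Rmult_le_compat; auto using Cmod_ge_0.
Qed.

Lemma unif_bounded_conj f : unif_bounded S f -> unif_bounded S (fun x => Cconj (f x)).
Proof. intros [M HM]; exists M; intros x Hx; rewrite Cmod_conj; auto. Qed.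

Lemma unif_bounded_unif_cv fn f : unif_bounded S (fn 0%nat) -> unif_cv S fn f -> unif_bounded S f.
Proof.
  intros [M HM] [K HK]; exists (M + K); intros x Hx.
  specialize (HM x Hx); specialize (HK 0%nat x Hx); cbn in HK; rewrite Rmult_1_r in HK.
  replace (f x) with (fn 0%nat x + - (fn 0%nat x - f x))%C by ring.
  eapply Rle_trans; [apply Cmod_triangle|]; rewrite Cmod_opp; lra.
Qed.
End Uniform.

Lemma unif_cv_subset {T U : Type} (S : T -> Prop) (S' : U -> Prop) (h : U -> T) fn f :
  (forall x, S' x -> S (h x)) -> unif_cv S fn f ->
  unif_cv S' (fun n x => fn n (h x)) (fun x => f (h x)).
Proof. intros H [K HK]; exists K; auto. Qed.

Lemma unif_cv_continuous {T : UniformSpace} (S : T -> Prop) fn f (x : T) :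
  locally x S -> S x -> unif_cv S fn f ->
  (forall n, continuous_C (fn n) x) -> continuous_C f x.
Proof.
  intros HS Hx [K HK] Hc.
  apply filterlim_locally_ball_norm; intros eps.
  destruct (pow_half_small K (eps / 3)) as [N HN].
  { destruct eps as [e He]; cbn; lra. }
  specialize (HN N (le_n N)).
  specialize (Hc N).
  apply filterlim_locally_ball_norm with (eps := pos_div_2 (pos_div_2 eps)) in Hc.
  generalize (filter_and _ _ HS Hc).
  apply filter_imp; intros y [Hy1 Hy2].
  unfold ball_norm in *.
  rewrite <- Cmod_norm in *.
  change (Cmod (fn N y - fn N x)%C < pos_div_2 (pos_div_2 eps)) in Hy2.
  change (Cmod (f y - f x)%C < eps).
  replace (f y - f x)%C with (- (fn N y - f y) + ((fn N y - fn N x) + (fn N x - f x)))%C by ring.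
  eapply Rle_lt_trans; [eapply Rle_trans; [apply Cmod_triangle|
    apply Rplus_le_compat_l, Cmod_triangle]|].
  rewrite Cmod_opp.
  pose proof (HK N x Hx); pose proof (HK N y Hy1).
  destruct eps as [e He]; cbn in *; lra.
Qed.

Lemma unif_cv_derive (fn fn' : nat -> R -> C) (f g : R -> C) (c : R) (r : posreal) :
  unif_cv (Boule c r) fn f -> unif_cv (Boule c r) fn' g ->
  (forall n y, Boule c r y -> is_derive_C (fn n) y (fn' n y)) ->
  (forall n y, Boule c r y -> continuous_C (fn' n) y) ->
  forall y, Boule c r y -> is_derive_C f y (g y).
Proof.
  intros Hf Hg Hd Hc y Hy.
  assert (gc : forall z, Boule c r z -> continuous_C g z).
  { intros z Hz; apply (unif_cv_continuous (Boule c r) fn'); auto.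
    assert (Hr : 0 < r - Rabs (z - c)) by (unfold Boule in Hz; lra).
    exists (mkposreal _ Hr); intros w Hw.
    change (Rabs (w - z) < r - Rabs (z - c)) in Hw; unfold Boule.
    replace (w - c) with ((w - z) + (z - c)) by ring.
    eapply Rle_lt_trans; [apply Rabs_triang|lra]. }
  (* [pr] is the real or the imaginary part; being additive and 1-Lipschitz is all that is used to
     reduce to the real theorem on termwise differentiation. *)
  assert (HR : forall (pr : C -> R), (forall z w : C, pr (z - w)%C = pr z - pr w) ->
     (forall z : C, Rabs (pr z) <= Cmod z) ->
     (forall n z, Boule c r z -> is_derive (fun t => pr (fn n t)) z (pr (fn' n z))) ->
     (forall z, Boule c r z -> continuous (fun t => pr (g t)) z) ->
     is_derive (fun t => pr (f t)) y (pr (g y))).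
  { intros pr Hpr1 Hpr2 Hd' Hg'.
    apply is_derive_Reals.
    apply (derivable_pt_lim_CVU (fun n t => pr (fn n t)) (fun n t => pr (fn' n t))
      (fun t => pr (f t)) (fun t => pr (g t)) y c r Hy).
    - intros z n Hz; apply is_derive_Reals; auto.
    - intros z Hz eps He.
      destruct Hf as [K HK]; destruct (pow_half_small K eps He) as [N HN].
      exists N; intros n Hn; unfold Rdist; rewrite <- Hpr1.
      eapply Rle_lt_trans; [apply Hpr2|]; eapply Rle_lt_trans; [apply HK|]; auto.
    - intros eps He.
      destruct Hg as [K HK]; destruct (pow_half_small K eps He) as [N HN].
      exists N; intros n z Hn Hz; rewrite Rabs_minus_sym, <- Hpr1.
      eapply Rle_lt_trans; [apply Hpr2|]; eapply Rle_lt_trans; [apply HK|]; auto.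
    - intros z Hz; apply continuity_pt_filterlim; apply Hg'; auto. }
  apply is_derive_C_pair; split.
  - apply (HR (fun z => fst z)); auto.
    + intros z; apply re_le_Cmod.
    + intros n z Hz; apply is_derive_C_pair; auto.
    + intros z Hz; apply continuous_C_pair; auto.
  - apply (HR (fun z => snd z)); auto.
    + intros z; pose proof (Rmax_Cmod z); pose proof (Rmax_r (Rabs (fst z)) (Rabs (snd z))); lra.
    + intros n z Hz; apply is_derive_C_pair; auto.
    + intros z Hz; apply continuous_C_pair; auto.
Qed.

(** Total, with an arbitrary value when there is no limit. The limit of the iterates can thus be
    written for every [t], although convergence is only known for [|t| < T]. *)
Definition Clim (f : nat -> C) : C :=
  (real (Lim_seq (fun n => fst (f n))), real (Lim_seq (fun n => snd (f n)))).

Lemma Lim_seq_geometric (a : nat -> R) (K : R) :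
  (forall n, Rabs (a (S n) - a n) <= K * (/ 2) ^ n) ->
  forall n, Rabs (a n - real (Lim_seq a)) <= 2 * K * (/ 2) ^ n.
Proof.
  intros Ha.
  (* The exact geometric sum, kept with its factor [1 - 2^-k] so that the induction on [k]
     closes. *)
  assert (Hnk : forall n k, Rabs (a (n + k)%nat - a n) <= 2 * K * (/ 2) ^ n * (1 - (/ 2) ^ k)).
  { intros n k; induction k as [|k IH].
    - rewrite Nat.add_0_r, Rminus_diag, Rabs_R0; cbn; lra.
    - rewrite Nat.add_succ_r.
      replace (a (S (n + k)) - a n)
        with ((a (S (n + k)) - a (n + k)%nat) + (a (n + k)%nat - a n)) by ring.
      eapply Rle_trans; [apply Rabs_triang|].
      specialize (Ha (n + k)%nat); rewrite pow_add in Ha; cbn [pow]; lra. }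
  assert (HK : 0 <= K).
  { specialize (Ha 0%nat); cbn in Ha; pose proof (Rabs_pos (a 1%nat - a 0%nat)); lra. }
  assert (Hnk' : forall n k, Rabs (a (n + k)%nat - a n) <= 2 * K * (/ 2) ^ n).
  { intros n k; eapply Rle_trans; [apply Hnk|].
    pose proof (pow_half_pos k); pose proof (pow_half_pos n).
    assert (0 <= 2 * K * (/ 2) ^ n) by nra; nra. }
  assert (Hex : ex_finite_lim_seq a).
  { apply ex_lim_seq_cauchy_corr; intros eps.
    destruct (pow_half_small (2 * K) (eps / 2)) as [N HN].
    { destruct eps; cbn; lra. }
    exists N; intros n m Hn Hm.
    specialize (HN N (le_n N)).
    pose proof (Hnk' N (n - N)%nat) as A; pose proof (Hnk' N (m - N)%nat) as B.
    replace (N + (n - N))%nat with n in A by lia.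
    replace (N + (m - N))%nat with m in B by lia.
    replace (a n - a m) with ((a n - a N) - (a m - a N)) by ring.
    eapply Rle_lt_trans; [apply Rabs_triang|]; rewrite Rabs_Ropp; lra. }
  apply Lim_seq_correct' in Hex.
  intros n.
  assert (H : is_lim_seq (fun k => Rabs (a n - a (n + k)%nat)) (Rabs (a n - real (Lim_seq a)))).
  { apply (is_lim_seq_abs (fun k => a n - a (n + k)%nat) (Finite (a n - real (Lim_seq a)))).
    apply is_lim_seq_minus'; [apply is_lim_seq_const|].
    apply (is_lim_seq_ext (fun k => a (k + n)%nat)); [intros; f_equal; lia|].
    now apply is_lim_seq_incr_n. }
  apply (is_lim_seq_le (fun k => Rabs (a n - a (n + k)%nat)) (fun _ => 2 * K * (/ 2) ^ n)
    (Finite (Rabs (a n - real (Lim_seq a)))) (Finite (2 * K * (/ 2) ^ n)));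
  [|exact H|apply is_lim_seq_const].
  intros k; rewrite Rabs_minus_sym; apply Hnk'.
Qed.

(** Each of the two coordinates contributes [2 K], whence the factor 4. *)
Lemma Clim_geometric (f : nat -> C) (K : R) :
  (forall n, Cmod (f (S n) - f n)%C <= K * (/ 2) ^ n) ->
  forall n, Cmod (f n - Clim f)%C <= 4 * K * (/ 2) ^ n.
Proof.
  intros Hf n.
  pose proof (Lim_seq_geometric (fun n => fst (f n)) K) as A.
  pose proof (Lim_seq_geometric (fun n => snd (f n)) K) as B.
  assert (Hm : forall z : C, Rabs (fst z) <= Cmod z /\ Rabs (snd z) <= Cmod z).
  { intros z; pose proof (Rmax_Cmod z);
    pose proof (Rmax_l (Rabs (fst z)) (Rabs (snd z)));
    pose proof (Rmax_r (Rabs (fst z)) (Rabs (snd z))); lra. }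
  assert (A' := fun HA => A HA n); assert (B' := fun HB => B HB n); clear A B.
  replace (f n - Clim f)%C
    with (RtoC (fst (f n) - fst (Clim f)) + RtoC (snd (f n) - snd (Clim f)) * Ci)%C.
  2: { apply injective_projections; cbn; ring. }
  eapply Rle_trans; [apply Cmod_triangle|].
  rewrite Cmod_mult, Cmod_Ci, !Cmod_R.
  cbn [Clim fst snd].
  enough (Rabs (fst (f n) - real (Lim_seq (fun n => fst (f n)))) <= 2 * K * (/ 2) ^ n /\
     Rabs (snd (f n) - real (Lim_seq (fun n => snd (f n)))) <= 2 * K * (/ 2) ^ n) by lra.
  split; [apply A' | apply B']; intros k; eapply Rle_trans; [apply (Hm (f (S k) - f k)%C) | apply
    Hf |
    apply (Hm (f (S k) - f k)%C) | apply Hf].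
Qed.

(** * Smoothness from the equation *)

(* Differential polynomials: [DVar i] stands for the [i]-th [x]-derivative of the
   solution.  Time derivatives are eliminated with the equation [u_t = rhs]. *)
Inductive diffpoly : Type :=
| DVar : nat -> diffpoly
| DCst : C -> diffpoly
| DAdd : diffpoly -> diffpoly -> diffpoly
| DMul : diffpoly -> diffpoly -> diffpoly
| DConj : diffpoly -> diffpoly.

Fixpoint eval (V : nat -> R -> R -> C) (e : diffpoly) (t x : R) : C :=
  match e with
  | DVar i => V i t x
  | DCst c => c
  | DAdd e1 e2 => (eval V e1 t x + eval V e2 t x)%C
  | DMul e1 e2 => (eval V e1 t x * eval V e2 t x)%C
  | DConj e1 => Cconj (eval V e1 t x)
  end.

Fixpoint deriv_x (e : diffpoly) : diffpoly :=
  match e with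
  | DVar i => DVar (S i)
  | DCst _ => DCst 0
  | DAdd e1 e2 => DAdd (deriv_x e1) (deriv_x e2)
  | DMul e1 e2 => DAdd (DMul (deriv_x e1) e2) (DMul e1 (deriv_x e2))
  | DConj e1 => DConj (deriv_x e1)
  end.

Fixpoint deriv_t (rhs : diffpoly) (e : diffpoly) : diffpoly :=
  match e with
  | DVar i => Nat.iter i deriv_x rhs
  | DCst _ => DCst 0
  | DAdd e1 e2 => DAdd (deriv_t rhs e1) (deriv_t rhs e2)
  | DMul e1 e2 => DAdd (DMul (deriv_t rhs e1) e2) (DMul e1 (deriv_t rhs e2))
  | DConj e1 => DConj (deriv_t rhs e1)
  end.

Lemma eval_deriv_t_deriv_x V rhs e t x : eval V (deriv_t rhs (deriv_x e)) t x =
  eval V (deriv_x (deriv_t rhs e)) t x.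
Proof.
  induction e as [i|c|e1 IH1 e2 IH2|e1 IH1 e2 IH2|e IH]; cbn; auto.
  - now rewrite IH1, IH2.
  - rewrite IH1, IH2; ring.
  - now rewrite IH.
Qed.

Lemma eval_derive_x V e t x :
  (forall i x', is_derive_C (V i t) x' (V (S i) t x')) ->
  is_derive_C (eval V e t) x (eval V (deriv_x e) t x).
Proof.
  intros HV; revert x.
  induction e as [i|c|e1 IH1 e2 IH2|e1 IH1 e2 IH2|e IH]; intros x; cbn.
  - apply HV.
  - apply is_derive_C_const.
  - now apply is_derive_C_plus.
  - now apply is_derive_C_mult.
  - now apply is_derive_C_conj.
Qed.

Lemma eval_derive_t V rhs e t x :
  (forall i, is_derive_C (fun t' => V i t' x) t (eval V (Nat.iter i deriv_x rhs) t x)) ->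
  is_derive_C (fun t' => eval V e t' x) t (eval V (deriv_t rhs e) t x).
Proof.
  intros HV.
  induction e as [i|c|e1 IH1 e2 IH2|e1 IH1 e2 IH2|e IH]; cbn.
  - apply HV.
  - apply is_derive_C_const.
  - now apply (is_derive_C_plus (fun t' => eval V e1 t' x) (fun t' => eval V e2 t' x)).
  - now apply (is_derive_C_mult (fun t' => eval V e1 t' x) (fun t' => eval V e2 t' x)).
  - now apply (is_derive_C_conj (fun t' => eval V e t' x)).
Qed.

Lemma eval_continuous {T : UniformSpace} V (f g : T -> R) (y : T) e :
  (forall i, continuous_C (fun y' => V i (f y') (g y')) y) ->
  continuous_C (fun y' => eval V e (f y') (g y')) y.
Proof.
  intros HV.
  induction e as [i|c|e1 IH1 e2 IH2|e1 IH1 e2 IH2|e IH]; cbn.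
  - apply HV.
  - apply continuous_const.
  - now apply continuous_C_plus.
  - now apply continuous_C_mult.
  - now apply continuous_C_conj.
Qed.

Section Limit.
Context {T : Type} (S : T -> Prop) (f g : T -> R).
Context (Vn : nat -> nat -> R -> R -> C) (V : nat -> R -> R -> C).
Hypothesis HV : forall i, unif_bounded S (fun y => V i (f y) (g y)).
Hypothesis HVn : forall i, unif_cv S (fun n y => Vn n i (f y) (g y)) (fun y => V i (f y) (g y)).

Lemma eval_unif_bounded e : unif_bounded S (fun y => eval V e (f y) (g y)).
Proof.
  induction e as [i|c|e1 IH1 e2 IH2|e1 IH1 e2 IH2|e IH]; cbn.
  - apply HV.
  - apply unif_bounded_const.
  - now apply unif_bounded_plus.
  - now apply unif_bounded_mult.
  - now apply unif_bounded_conj.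
Qed.

Lemma eval_unif_cv e :
  unif_cv S (fun n y => eval (Vn n) e (f y) (g y)) (fun y => eval V e (f y) (g y)).
Proof.
  induction e as [i|c|e1 IH1 e2 IH2|e1 IH1 e2 IH2|e IH]; cbn.
  - apply HVn.
  - apply unif_cv_const.
  - now apply (unif_cv_plus S (fun n y => eval (Vn n) e1 (f y) (g y)) _ (fun n y => eval (Vn n)
    e2 (f y) (g y))).
  - apply (unif_cv_mult S (fun n y => eval (Vn n) e1 (f y) (g y)) _ (fun n y => eval (Vn n) e2 (f
    y) (g y)));
    auto using eval_unif_bounded.
  - now apply (unif_cv_conj S (fun n y => eval (Vn n) e (f y) (g y))).
Qed.
End Limit.

(** The filter of neighbourhoods within [A] is finer than the full one, so a two-sided derivative
    serves also at the end points; [A x] makes that filter proper. *)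
Lemma is_derive_C_within (A : R -> Prop) (f : R -> C) (x : R) (l : C) :
  A x -> is_derive_C f x l -> is_derive_within A f x l.
Proof.
  intros Hx H.
  assert (HP : ProperFilter (within A (locally x))).
  { split; [|typeclasses eauto].
    intros P HP; exists x; exact (locally_singleton _ _ HP Hx). }
  refine (@filterdiff_locally R_AbsRing R_NormedModule CR (within A (locally x)) HP f x _ _ H).
  intros P HPx; apply filter_le_within; exact HPx.
Qed.

Section Smooth.
Variables (T delta : R) (V : nat -> R -> R -> C) (rhs : diffpoly).
Hypothesis HT : delta < T.
Hypothesis HVx : forall i t x, Rabs t < T -> is_derive_C (V i t) x (V (S i) t x).
Hypothesis HVt : forall i t x, Rabs t < T ->
  is_derive_C (fun t' => V i t' x) t (eval V (Nat.iter i deriv_x rhs) t x).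
Hypothesis HVc : forall i t x, Rabs t < T ->
  continuous_C (fun q : R * R => V i (fst q) (snd q)) (t, x).

(** Time derivatives are applied innermost. The clause on [x]-derivatives is then immediate, and
    only the clause on [t]-derivatives needs the commutation below. *)
Definition partials (j k : nat) : R -> R -> C :=
  eval V (Nat.iter k deriv_x (Nat.iter j (deriv_t rhs) (DVar 0))).

(* [deriv_t] and [deriv_x] commute only up to evaluation; uniqueness of the
   [x]-derivative carries the equality through further [x]-derivatives. *)
Lemma eval_deriv_t_iter_deriv_x e k t x : Rabs t < T ->
  eval V (deriv_t rhs (Nat.iter k deriv_x e)) t x = eval V (Nat.iter k deriv_x (deriv_t rhs e)) t x.
Proof.
  intros Ht; revert x; induction k as [|k IH]; intros x; [reflexivity|].
  cbn [Nat.iter nat_rect].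
  rewrite eval_deriv_t_deriv_x.
  apply (is_derive_C_unique (eval V (deriv_t rhs (Nat.iter k deriv_x e)) t) x _ _).
  - apply eval_derive_x; auto.
  - eapply is_derive_C_ext; [intros y; symmetry; apply IH|].
    apply eval_derive_x; auto.
Qed.

Lemma smooth_partials : smooth_with_partials delta (V 0%nat) partials.
Proof.
  assert (HS : forall t, 0 <= t <= delta -> Rabs t < T).
  { intros t Ht; rewrite Rabs_pos_eq; lra. }
  split; [|split; [|split]].
  - reflexivity.
  - intros j k t x Ht.
    apply is_derive_C_within; [exact Ht|].
    unfold partials; cbn [Nat.iter nat_rect].
    rewrite <- eval_deriv_t_iter_deriv_x by auto.
    apply eval_derive_t; auto.
  - intros j k t x Ht; unfold partials; cbn [Nat.iter nat_rect].
    apply eval_derive_x; auto.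
  - intros j k [t x] Ht.
    eapply filterlim_filter_le_1; [apply filter_le_within|].
    apply (eval_continuous (T := prod_UniformSpace R_UniformSpace R_UniformSpace) V fst snd (t,
      x)); auto.
Qed.
End Smooth.

Fixpoint dpow (e : diffpoly) (n : nat) : diffpoly :=
  match n with O => DCst 1 | S n' => DMul e (dpow e n') end.

Definition Fexpr (q : nat) : diffpoly := DMul (dpow (DMul (DVar 0) (DConj (DVar 0))) q) (DVar 0).

(** The equation multiplied by [Ci] and solved for [u_t]. *)
Definition nls_rhs (omega : R) (q : nat) : diffpoly :=
  DAdd (DMul (DCst (- Ci)) (DVar 2)) (DMul (DCst (RtoC omega * Ci)) (Fexpr q)).

(** This is where [p] odd enters: [|z|^(p - 1) z] becomes a polynomial in [z] and its conjugate, so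
    it maps trigonometric polynomials to trigonometric polynomials. *)
Definition nonlin (q : nat) (z : C) : C := ((z * Cconj z) ^ q * z)%C.

Lemma eval_Fexpr V q t x : eval V (Fexpr q) t x = nonlin q (V 0%nat t x).
Proof.
  cbn; unfold nonlin; f_equal.
  induction q as [|q IH]; [reflexivity|].
  cbn in *; now rewrite IH.
Qed.

Lemma nonlin_Cmod (q : nat) (z : C) : nonlin q z = (RtoC (Cmod z ^ (2 * q)) * z)%C.
Proof.
  unfold nonlin; f_equal.
  rewrite pow_mult.
  induction q as [|q IH]; [reflexivity|].
  cbn [Cpow]; rewrite IH, <- Cmod2_conj.
  now rewrite <- RtoC_mult.
Qed.

Lemma smooth_NLS_of_modes (omega T delta : R) (q : nat) (V : nat -> R -> R -> C) :
  delta < T ->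
  (forall i t x, Rabs t < T -> is_derive_C (V i t) x (V (S i) t x)) ->
  (forall i t x, Rabs t < T ->
     is_derive_C (fun t' => V i t' x) t (eval V (Nat.iter i deriv_x (nls_rhs omega q)) t x)) ->
  (forall i t x, Rabs t < T -> continuous_C (fun q : R * R => V i (fst q) (snd q)) (t, x)) ->
  (forall t x, Rabs t < T -> V 0%nat t (x + 2 * PI) = V 0%nat t x) ->
  smooth_NLS_solution omega (2 * q + 1) delta (V 0%nat).
Proof.
  intros HT HVx HVt HVc Hper; split.
  { intros t x Ht; apply Hper; rewrite Rabs_pos_eq; lra. }
  exists (partials V (nls_rhs omega q)); split.
  { eapply smooth_partials; eauto. }
  intros t x Ht.
  replace (2 * q + 1 - 1)%nat with (2 * q)%nat by lia.
  rewrite <- Cmult_assoc, <- nonlin_Cmod.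
  unfold partials; cbn [Nat.iter nat_rect deriv_t deriv_x]. 
  unfold nls_rhs at 1; cbn [eval]; rewrite eval_Fexpr.
  set (F := nonlin q (V 0%nat t x)); set (W := V 2%nat t x).
  transitivity (Ci * Ci * W + W - RtoC omega * (Ci * Ci) * F)%C; [ring|].
  replace (Ci * Ci)%C with (RtoC (-1)) by (apply injective_projections; cbn; ring).
  apply injective_projections; cbn; ring.
Qed.

(** * Trigonometric polynomials with time-dependent coefficients *)

(* The pair [(k, c)] stands for [c(t) e^{ikNx}]; repeated frequencies are allowed,
   so that products need no regrouping. *)
Definition atom : Type := (Z * (R -> C))%type.

(** Submultiplicative, which makes [wnorm] an algebra norm, and larger than every power of [|k|] up
    to a constant, so that one bound on [wnorm] controls all [x]-derivatives. *)
Definition weight (k : Z) : R := exp (Rabs (IZR k)).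

Lemma weight_pos k : 0 < weight k.
Proof. apply exp_pos. Qed.

Lemma weight_plus j k : weight (j + k) <= weight j * weight k.
Proof.
  unfold weight; rewrite <- exp_plus, plus_IZR.
  destruct (Rle_lt_or_eq_dec _ _ (Rabs_triang (IZR j) (IZR k))) as [H|H].
  - left; now apply exp_increasing.
  - right; now f_equal.
Qed.

Lemma weight_opp k : weight (- k) = weight k.
Proof. unfold weight; now rewrite opp_IZR, Rabs_Ropp. Qed.

(** A quantity attached to the list, not to the function it codes: atoms of equal frequency are not
    merged, so no cancellation is seen. *)
Fixpoint wnorm (l : list atom) (t : R) : R :=
  match l with
  | [] => 0
  | (k, c) :: l' => Cmod (c t) * weight k + wnorm l' t
  end.

Lemma wnorm_pos l t : 0 <= wnorm l t.
Proof.
  induction l as [|[k c] l IH]; cbn; [lra|].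
  pose proof (weight_pos k); pose proof (Cmod_ge_0 (c t)); nra.
Qed.

Lemma wnorm_app l1 l2 t : wnorm (l1 ++ l2) t = wnorm l1 t + wnorm l2 t.
Proof. induction l1 as [|[k c] l IH]; cbn; [ring|rewrite IH; ring]. Qed.

Definition acont (a : atom) : Prop := forall t : R, continuous_C (snd a) t.

Definition amul (a b : atom) : atom :=
  ((fst a + fst b)%Z, fun t => (snd a t * snd b t)%C).

Definition trig_mul (l1 l2 : list atom) : list atom :=
  flat_map (fun a => map (amul a) l2) l1.

Definition trig_conj (l : list atom) : list atom :=
  map (fun a : atom => ((- fst a)%Z, fun t => Cconj (snd a t))) l.

Lemma acont_amul a b : acont a -> acont b -> acont (amul a b).
Proof. intros Ha Hb t; now apply continuous_C_mult. Qed.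

Lemma acont_trig_mul l1 l2 : Forall acont l1 -> Forall acont l2 -> Forall acont (trig_mul l1 l2).
Proof.
  intros H1 H2; apply Forall_flat_map; revert H1; apply Forall_impl.
  intros a Ha; apply Forall_map; revert H2; apply Forall_impl.
  intros b; now apply acont_amul.
Qed.

Lemma acont_trig_conj l : Forall acont l -> Forall acont (trig_conj l).
Proof.
  intros H; apply Forall_map; revert H; apply Forall_impl.
  intros a Ha t; now apply continuous_C_conj.
Qed.

Lemma wnorm_map_amul a l t :
  wnorm (map (amul a) l) t <= Cmod (snd a t) * weight (fst a) * wnorm l t.
Proof.
  induction l as [|[k c] l IH]; cbn; [lra|].
  rewrite Cmod_mult.
  pose proof (weight_plus (fst a) k).
  assert (0 <= Cmod (snd a t) * Cmod (c t)) by (apply Rmult_le_pos; apply Cmod_ge_0).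
  nra.
Qed.

Lemma wnorm_trig_mul l1 l2 t : wnorm (trig_mul l1 l2) t <= wnorm l1 t * wnorm l2 t.
Proof.
  unfold trig_mul; induction l1 as [|[k c] l IH]; cbn; [lra|].
  rewrite wnorm_app.
  pose proof (wnorm_map_amul (k, c) l2 t); cbn in *; lra.
Qed.

Lemma wnorm_trig_conj l t : wnorm (trig_conj l) t = wnorm l t.
Proof.
  induction l as [|[k c] l IH]; cbn; [reflexivity|].
  fold (trig_conj l).
  now rewrite Cmod_conj, weight_opp, IH.
Qed.

Lemma wnorm_continuous l t : Forall acont l -> continuous (wnorm l) t.
Proof.
  induction l as [|[k c] l IH]; intros H.
  - apply continuous_const.
  - inversion H; subst.
    apply (continuous_plus (fun t => Cmod (c t) * weight k) (wnorm l)); auto.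
    apply (continuous_mult (K := R_AbsRing) (fun t => Cmod (c t)) (fun _ => weight k)).
    + apply continuous_Cmod; apply (H2 t).
    + apply continuous_const.
Qed.

Section Frequency.
Variable N : nat.

Definition freq (k : Z) : R := IZR k * INR N.

(** The index [i] is the order of a termwise [x]-derivative. *)
Fixpoint trig_eval (i : nat) (l : list atom) (t x : R) : C :=
  match l with
  | [] => 0%C
  | (k, c) :: l' => ((RtoC (freq k) * Ci) ^ i * c t * cis (freq k * x) + trig_eval i l' t x)%C
  end.

Lemma trig_eval_app i l1 l2 t x : trig_eval i (l1 ++ l2) t x =
  (trig_eval i l1 t x + trig_eval i l2 t x)%C.
Proof. induction l1 as [|[k c] l IH]; cbn; [ring|rewrite IH; ring]. Qed.

Lemma trig_eval_trig_mul l1 l2 t x : trig_eval 0 (trig_mul l1 l2) t x =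
  (trig_eval 0 l1 t x * trig_eval 0 l2 t x)%C.
Proof.
  unfold trig_mul; induction l1 as [|[k c] l IH]; cbn; [ring|].
  rewrite trig_eval_app, IH.
  assert (H : trig_eval 0 (map (amul (k, c)) l2) t x =
    (c t * cis (freq k * x) * trig_eval 0 l2 t x)%C).
  { clear IH; induction l2 as [|[j d] l2 IH]; cbn; [ring|].
    rewrite IH; unfold freq; rewrite plus_IZR.
    replace ((IZR k + IZR j) * INR N * x) with (IZR k * INR N * x + IZR j * INR N * x) by ring.
    rewrite cis_plus; ring. }
  rewrite H; ring.
Qed.

Lemma trig_eval_trig_conj l t x : trig_eval 0 (trig_conj l) t x = Cconj (trig_eval 0 l t x).
Proof.
  induction l as [|[k c] l IH]; cbn.
  - apply injective_projections; cbn; ring.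
  - fold (trig_conj l); rewrite IH, Cplus_conj, !Cmult_conj.
    unfold freq; rewrite opp_IZR.
    replace (- IZR k * INR N * x) with (- (IZR k * INR N * x)) by ring.
    rewrite cis_opp; f_equal; f_equal; f_equal.
    apply injective_projections; cbn; ring.
Qed.

Lemma trig_eval_bound i l t x : Cmod (trig_eval i l t x) <= INR N ^ i * INR (fact i) * wnorm l t.
Proof.
  induction l as [|[k c] l IH]; cbn [trig_eval wnorm]; [rewrite Cmod_0; lra|].
  eapply Rle_trans; [apply Cmod_triangle|].
  rewrite Rmult_plus_distr_l; apply Rplus_le_compat; [|exact IH].
  rewrite !Cmod_mult, Cmod_cis, Cmod_pow, Cmod_mult, Cmod_Ci, Cmod_R, !Rmult_1_r.
  unfold freq; rewrite Rabs_mult, (Rabs_pos_eq (INR N)) by apply pos_INR.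
  rewrite Rpow_mult_distr.
  (* A single term of the exponential series is at most the whole series. *)
  assert (H : Rabs (IZR k) ^ i <= INR (fact i) * weight k).
  { pose proof (exp_ge_taylor (Rabs (IZR k)) i (Rabs_pos _)) as H.
    pose proof (INR_fact_lt_0 i) as Hf.
    assert (H' : Rabs (IZR k) ^ i / INR (fact i) <= weight k).
    { eapply Rle_trans; [|exact H].
      destruct i as [|i]; [cbn; lra|].
      cbn [sum_f_R0].
      enough (0 <= sum_f_R0 (fun k0 => Rabs (IZR k) ^ k0 / INR (fact k0)) i) by lra.
      apply cond_pos_sum; intros n; apply Rmult_le_pos; [apply pow_le, Rabs_pos|].
      left; apply Rinv_0_lt_compat, INR_fact_lt_0. }
    apply Rmult_le_compat_l with (r := INR (fact i)) in H'; [|lra].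
    replace (INR (fact i) * (Rabs (IZR k) ^ i / INR (fact i))) with (Rabs (IZR k) ^ i) in H'
      by (field; lra).
    exact H'. }
  pose proof (pow_le _ i (pos_INR N)); pose proof (Cmod_ge_0 (c t)).
  apply Rmult_le_compat_l with (r := INR N ^ i * Cmod (c t)) in H; [|now apply Rmult_le_pos].
  lra.
Qed.

Lemma trig_eval_derive_x i l t x : is_derive_C (trig_eval i l t) x (trig_eval (S i) l t x).
Proof.
  induction l as [|[k c] l IH].
  - apply is_derive_C_const.
  - apply (is_derive_C_plus (fun x => ((RtoC (freq k) * Ci) ^ i * c t * cis (freq k * x))%C)
    (trig_eval i l t));
      [|exact IH].
    pose proof (is_derive_C_mult (fun _ => ((RtoC (freq k) * Ci) ^ i * c t)%C)
      (fun x => cis (freq k * x)) x _ _ (is_derive_C_const _ x) (is_derive_cis (freq k) x)) as H.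
    cbv beta in H.
    replace ((RtoC (freq k) * Ci) ^ S i * c t * cis (freq k * x))%C with
      (0 * cis (freq k * x) + (RtoC (freq k) * Ci) ^ i * c t * (freq k * Ci * cis (freq k * x)))%C;
      [exact H|cbn [Cpow]; ring].
Qed.

Lemma trig_eval_continuous {T : UniformSpace} (f g : T -> R) (y : T) i l : Forall acont l ->
  continuous f y -> continuous g y -> continuous_C (fun y' => trig_eval i l (f y') (g y')) y.
Proof.
  intros Hl Hf Hg.
  induction l as [|[k c] l IH]; cbn.
  - apply continuous_const.
  - inversion Hl; subst.
    apply continuous_C_plus; [|auto].
    apply continuous_C_mult; [apply continuous_C_mult|].
    + apply continuous_const.
    + apply (continuous_comp (U := T) f c); [exact Hf|apply (H1 (f y))].
    + apply continuous_cis.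
      apply (continuous_mult (K := R_AbsRing) (fun _ => freq k) g); [apply continuous_const|exact
        Hg].
Qed.

Lemma trig_eval_periodic i l t x : trig_eval i l t (x + 2 * PI) = trig_eval i l t x.
Proof.
  induction l as [|[k c] l IH]; cbn [trig_eval]; [reflexivity|].
  rewrite IH; do 2 f_equal.
  unfold freq; rewrite INR_IZR_INZ, <- mult_IZR.
  set (m := (k * Z.of_nat N)%Z).
  rewrite Rmult_plus_distr_l, cis_plus.
  replace (cis (IZR m * (2 * PI))) with (RtoC 1); [ring|].
  unfold cis; apply injective_projections; cbn.
  - destruct (Z_le_dec 0 m).
    + replace (IZR m) with (INR (Z.to_nat m)) by (rewrite INR_IZR_INZ; f_equal; lia).
      replace (INR (Z.to_nat m) * (2 * PI)) with (0 + 2 * INR (Z.to_nat m) * PI) by ring.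
      now rewrite cos_period, cos_0.
    + replace (IZR m) with (- INR (Z.to_nat (- m)))
        by (rewrite INR_IZR_INZ, <- opp_IZR; f_equal; lia).
      replace (- INR (Z.to_nat (- m)) * (2 * PI)) with (- (0 + 2 * INR (Z.to_nat (- m)) * PI)) by
        ring.
      now rewrite cos_neg, cos_period, cos_0.
  - destruct (Z_le_dec 0 m).
    + replace (IZR m) with (INR (Z.to_nat m)) by (rewrite INR_IZR_INZ; f_equal; lia).
      replace (INR (Z.to_nat m) * (2 * PI)) with (0 + 2 * INR (Z.to_nat m) * PI) by ring.
      now rewrite sin_period, sin_0.
    + replace (IZR m) with (- INR (Z.to_nat (- m)))
        by (rewrite INR_IZR_INZ, <- opp_IZR; f_equal; lia).
      replace (- INR (Z.to_nat (- m)) * (2 * PI)) with (- (0 + 2 * INR (Z.to_nat (- m)) * PI)) by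
        ring.
      now rewrite sin_neg, sin_period, sin_0, Ropp_0.
Qed.
End Frequency.

(** * Duhamel integrals and differences of the nonlinearity *)

Definition CInt (g : R -> C) (t : R) : C :=
  (RInt (fun s => fst (g s)) 0 t, RInt (fun s => snd (g s)) 0 t).

Lemma CInt_derive (g : R -> C) (t : R) :
  (forall s, continuous_C g s) -> is_derive_C (CInt g) t (g t).
Proof.
  intros Hg; apply is_derive_C_pair; cbn; split.
  - apply (is_derive_RInt (fun s => fst (g s)) _ 0).
    + apply filter_forall; intros b; apply (RInt_correct (V := R_CompleteNormedModule)).
      apply (ex_RInt_continuous (V := R_CompleteNormedModule)); intros; apply continuous_C_pair, Hg.
    + apply continuous_C_pair, Hg.
  - apply (is_derive_RInt (fun s => snd (g s)) _ 0).
    + apply filter_forall; intros b; apply (RInt_correct (V := R_CompleteNormedModule)).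
      apply (ex_RInt_continuous (V := R_CompleteNormedModule)); intros; apply continuous_C_pair, Hg.
    + apply continuous_C_pair, Hg.
Qed.

Lemma CInt_0 (g : R -> C) : CInt g 0 = 0%C.
Proof. unfold CInt; now rewrite !RInt_point. Qed.

Lemma CInt_bound (g : R -> C) (t : R) : (forall s, continuous_C g s) ->
  Cmod (CInt g t) <= RInt (fun s => Cmod (g s)) (Rmin 0 t) (Rmax 0 t).
Proof.
  intros Hg.
  assert (H1 : forall a b, is_RInt (V := CR) g a b
     (RInt (fun s => fst (g s)) a b, RInt (fun s => snd (g s)) a b)).
  { intros a b; apply is_RInt_fct_extend_pair; apply (RInt_correct (V := R_CompleteNormedModule));
    apply (ex_RInt_continuous (V := R_CompleteNormedModule)); intros; apply continuous_C_pair, Hg. }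
  assert (H2 : forall a b, is_RInt (fun s => Cmod (g s)) a b (RInt (fun s => Cmod (g s)) a b)).
  { intros a b; apply (RInt_correct (V := R_CompleteNormedModule)).
    apply (ex_RInt_continuous (V := R_CompleteNormedModule)); intros; apply continuous_Cmod, Hg. }
  assert (H3 : forall a b, a <= b ->
    Cmod (RInt (fun s => fst (g s)) a b, RInt (fun s => snd (g s)) a b) <=
      RInt (fun s => Cmod (g s)) a b).
  { intros a b Hab; rewrite Cmod_norm.
    eapply norm_RInt_le; [exact Hab| |apply H1|apply H2].
    intros x _; rewrite <- Cmod_norm; lra. }
  destruct (Rle_dec 0 t) as [Ht|Ht].
  - rewrite Rmin_left, Rmax_right by lra; apply H3, Ht.
  - rewrite Rmin_right, Rmax_left by lra.
    unfold CInt.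
    rewrite <- (opp_RInt_swap (V := R_CompleteNormedModule) (fun s => fst (g s))),
      <- (opp_RInt_swap (V := R_CompleteNormedModule) (fun s => snd (g s)));
    try (apply (ex_RInt_continuous (V := R_CompleteNormedModule)); intros; apply
      continuous_C_pair, Hg).
    rewrite <- Cmod_opp.
    eapply Rle_trans; [|apply (H3 t 0); lra].
    right; f_equal; apply injective_projections; cbn; apply Ropp_involutive.
Qed.

(** Integrating the exponential gains [1 / M]. With [M = 2 L] a Duhamel integral with Lipschitz
    constant [L] contracts by one half on a time interval of any length. *)
Lemma RInt_exp_bound (h : R -> R) (K M t : R) : 0 <= K -> 0 < M ->
  (forall s, continuous h s) -> (forall s, Rabs s <= Rabs t -> h s <= K * exp (M * Rabs s)) ->
  RInt h (Rmin 0 t) (Rmax 0 t) <= K / M * exp (M * Rabs t).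
Proof.
  intros HK HM Hc Hh.
  assert (Hex : forall a b, ex_RInt h a b).
  { intros a b; apply (ex_RInt_continuous (V := R_CompleteNormedModule)); auto. }
  assert (Hexp : forall m a b, m <> 0 -> is_RInt (fun s => K * exp (m * s)) a b
    (K / m * exp (m * b) - K / m * exp (m * a))).
  { intros m a b Hm.
    apply (is_RInt_derive (V := R_CompleteNormedModule) (fun s => K / m * exp (m * s))).
    - intros x _; auto_derive; [trivial|field; lra].
    - intros x _; apply (ex_derive_continuous (K := R_AbsRing) (V := R_NormedModule));
      auto_derive; trivial. }
  assert (HKM : 0 <= K / M) by (apply Rmult_le_pos; [lra|left; now apply Rinv_0_lt_compat]).
  destruct (Rle_dec 0 t) as [Ht|Ht].
  - rewrite Rmin_left, Rmax_right by lra.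
    eapply Rle_trans.
    + apply RInt_le with (g := fun s => K * exp (M * s)); [exact Ht|apply Hex|eexists; apply
      Hexp; lra|].
      intros x Hx; specialize (Hh x); rewrite !Rabs_pos_eq in Hh by lra; apply Hh; lra.
    + rewrite (is_RInt_unique _ _ _ _ (Hexp M 0 t ltac:(lra))), Rmult_0_r, exp_0, Rabs_pos_eq by
      lra.
      lra.
  - rewrite Rmin_right, Rmax_left by lra.
    eapply Rle_trans.
    + apply RInt_le with (g := fun s => K * exp (- M * s)); [lra|apply Hex|eexists; apply Hexp;
      lra|].
      intros x Hx; specialize (Hh x); rewrite !Rabs_left in Hh by lra.
      replace (- M * x) with (M * - x) by ring; apply Hh; lra.
    + rewrite (is_RInt_unique _ _ _ _ (Hexp (- M) t 0 ltac:(lra))), Rmult_0_r, exp_0, Rabs_left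
      by lra.
      replace (- M * t) with (M * - t) by ring.
      replace (K / - M) with (- (K / M)) by (field; lra); lra.
Qed.

Section Duhamel.
Variables (N : nat) (omega : R).
Hypothesis Homega : Rabs omega = 1.

(** Variation of constants on one Fourier mode, where [- Ci * u_xx] acts as multiplication by
    [Ci (k N)^2]; the integral starts from zero data. *)
Definition duhamel_atom (a : atom) : atom :=
  (fst a, fun t => (RtoC omega * Ci * cis (freq N (fst a) ^ 2 * t)
     * CInt (fun s => cis (- (freq N (fst a) ^ 2) * s) * snd a s) t)%C).

Definition duhamel (l : list atom) : list atom := map duhamel_atom l.

Lemma linear_cis_continuous (m t : R) : continuous_C (fun s => cis (m * s)) t.
Proof. eapply is_derive_C_continuous, is_derive_cis. Qed.

Lemma duhamel_integrand_continuous (a : atom) s : acont a ->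
  continuous_C (fun s => (cis (- (freq N (fst a) ^ 2) * s) * snd a s)%C) s.
Proof. intros Ha; apply continuous_C_mult; [apply linear_cis_continuous|apply Ha]. Qed.

Lemma duhamel_atom_derive (a : atom) t : acont a ->
  is_derive_C (snd (duhamel_atom a)) t
    (Ci * RtoC (freq N (fst a) ^ 2) * snd (duhamel_atom a) t + RtoC omega * Ci * snd a t)%C.
Proof.
  intros Ha.
  set (k2 := freq N (fst a) ^ 2).
  pose proof (is_derive_C_mult (fun t => RtoC omega * Ci * cis (k2 * t))%C
     (CInt (fun s => cis (- k2 * s) * snd a s)%C) t _ _
     (is_derive_C_mult (fun _ => RtoC omega * Ci)%C (fun t => cis (k2 * t)) t _ _
        (is_derive_C_const _ t) (is_derive_cis k2 t))
     (CInt_derive _ t (fun s => duhamel_integrand_continuous a s Ha))) as H.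
  cbv beta in H; fold k2 in H.
  unfold duhamel_atom; cbn [fst snd]; fold k2.
  match type of H with is_derive_C _ _ ?l => match goal with |- is_derive_C _ _ ?l' =>
    replace l' with l; [exact H|] end end.
  replace (RtoC omega * Ci * snd a t)%C with (RtoC omega * Ci * (cis (k2 * t) * cis (- k2 * t)) *
    snd a t)%C.
  - ring.
  - rewrite <- cis_plus; replace (k2 * t + - k2 * t) with 0 by ring; rewrite cis_0; ring.
Qed.

Lemma acont_duhamel l : Forall acont l -> Forall acont (duhamel l).
Proof.
  intros H; apply Forall_map; revert H; apply Forall_impl.
  intros a Ha t; eapply is_derive_C_continuous, duhamel_atom_derive, Ha.
Qed.

Lemma trig_eval_duh_derive i l t x : Forall acont l ->
  is_derive_C (fun t => trig_eval N i (duhamel l) t x) t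
    (- Ci * trig_eval N (S (S i)) (duhamel l) t x + RtoC omega * Ci * trig_eval N i l t x)%C.
Proof.
  intros Hl; induction l as [|[k c] l IH].
  - replace (- Ci * trig_eval N (S (S i)) (duhamel []) t x + omega * Ci * trig_eval N i [] t x)%C
    with (RtoC 0)
      by (cbn; ring).
    exact (is_derive_C_const (RtoC 0) t).
  - inversion Hl; subst.
    set (F := RtoC (freq N k)).
    pose proof (is_derive_C_mult _ _ t _ _
      (is_derive_C_mult (fun _ => (F * Ci) ^ i)%C (snd (duhamel_atom (k, c))) t _ _
         (is_derive_C_const _ t) (duhamel_atom_derive (k, c) t H1))
      (is_derive_C_const (cis (freq N k * x)) t)) as H.
    pose proof (is_derive_C_plus _ _ t _ _ H (IH H2)) as H'.
    cbv beta in H'.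
    unfold duhamel; cbn [map trig_eval]; fold (duhamel l); unfold duhamel_atom at 1.
    unfold duhamel_atom in H' at 1 2 3; cbn [fst snd] in *.
    match type of H' with is_derive_C _ _ ?l => match goal with |- is_derive_C _ _ ?l' =>
      replace l' with l; [exact H'|] end end.
    unfold duhamel_atom; cbn [fst snd].
    set (D := (RtoC omega * Ci * cis (freq N k ^ 2 * t) *
       CInt (fun s => cis (- (freq N k ^ 2) * s) * c s) t)%C).
    replace (RtoC (freq N k ^ 2)) with (F * F)%C.
    2: { unfold F; rewrite <- RtoC_mult; f_equal; ring. }
    cbn [Cpow]; fold F; set (P := ((F * Ci) ^ i)%C).
    assert (HCi : (Ci * Ci)%C = (- RtoC 1)%C) by (apply injective_projections; cbn; ring).
    replace (F * Ci * (F * Ci * P))%C with (Ci * Ci * (F * F * P))%C by ring.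
    rewrite HCi; ring.
Qed.

Lemma trig_eval_duh_0 i l x : trig_eval N i (duhamel l) 0 x = 0%C.
Proof.
  induction l as [|[k c] l IH]; cbn; [reflexivity|].
  fold (duhamel l); rewrite IH, CInt_0; ring.
Qed.

(** The free flow multiplies each mode by a number of modulus one and [|omega| = 1], so only the
    time integral of the norm remains. *)
Lemma wnorm_duhamel_RInt l t : Forall acont l ->
  wnorm (duhamel l) t <= RInt (wnorm l) (Rmin 0 t) (Rmax 0 t).
Proof.
  intros Hl; induction l as [|[k c] l IH].
  - right; rewrite (RInt_ext (wnorm []) (fun _ => 0)) by reflexivity.
    rewrite RInt_const; symmetry; apply Rmult_0_r.
  - inversion Hl; subst.
    assert (E1 : forall a b, ex_RInt (fun s => Cmod (c s)) a b).
    { intros; apply (ex_RInt_continuous (V := R_CompleteNormedModule)); intros; apply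
      continuous_Cmod, H1. }
    assert (E1' : forall a b, ex_RInt (fun s => weight k * Cmod (c s)) a b).
    { intros; apply (ex_RInt_scal (V := R_CompleteNormedModule) (fun s => Cmod (c s))), E1. }
    assert (E2 : forall a b, ex_RInt (wnorm l) a b).
    { intros; apply (ex_RInt_continuous (V := R_CompleteNormedModule)); intros; now apply
      wnorm_continuous. }
    rewrite (RInt_ext (wnorm ((k, c) :: l)) (fun s => plus (weight k * Cmod (c s)) (wnorm l s))).
    2: { intros; cbn; unfold plus; cbn; ring. }
    rewrite (RInt_plus (V := R_CompleteNormedModule)) by auto.
    rewrite (RInt_scal (V := R_CompleteNormedModule) (fun s => Cmod (c s))) by auto.
    cbn [duhamel map wnorm]; fold (duhamel l); unfold duhamel_atom; cbn [fst snd].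
    apply Rplus_le_compat; [|auto].
    rewrite !Cmod_mult, Cmod_cis, Cmod_Ci, Cmod_R, Homega, !Rmult_1_l.
    change (Cmod (CInt (fun s => cis (- (freq N k ^ 2) * s) * c s)%C t) * weight k <=
      weight k * RInt (fun s => Cmod (c s)) (Rmin 0 t) (Rmax 0 t)).
    rewrite Rmult_comm.
    apply Rmult_le_compat_l; [left; apply weight_pos|].
    eapply Rle_trans; [apply CInt_bound; intros; now apply (duhamel_integrand_continuous (k, c))|].
    right; apply RInt_ext; intros; rewrite Cmod_mult, Cmod_cis; cbn; ring.
Qed.
End Duhamel.

(** Codes [|l + d|^2 - |l|^2]. As [wnorm] is blind to cancellation, differences must be expanded
    until a factor [d] or its conjugate stands in every product. *)
Definition sq_diff (l d : list atom) : list atom := trig_mul d (trig_conj l) ++ trig_mul (l ++ d)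
  (trig_conj d).

Fixpoint sq_pow (l : list atom) (n : nat) : list atom :=
  match n with
  | O => [(0%Z, fun _ => RtoC 1)]
  | S n' => trig_mul (trig_mul l (trig_conj l)) (sq_pow l n')
  end.

(** The splitting [X^(n+1) - Y^(n+1) = (X - Y) Y^n + X (X^n - Y^n)] for [X = |l + d|^2] and
    [Y = |l|^2], with [X] itself coded as [Y + (X - Y)]. *)
Fixpoint sq_pow_diff (l d : list atom) (n : nat) : list atom :=
  match n with
  | O => []
  | S n' => trig_mul (sq_diff l d) (sq_pow l n') ++ trig_mul (trig_mul l (trig_conj l) ++ sq_diff
    l d) (sq_pow_diff l d n')
  end.

(* Codes [F(l + d) - F(l)] for the nonlinearity [F], as a sum of products each
   containing a factor [d]. *)
Definition nonlin_diff (q : nat) (l d : list atom) : list atom :=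
  trig_mul (sq_pow_diff l d q) l ++ trig_mul (sq_pow l q ++ sq_pow_diff l d q) d.

Section Differences.
Variables (N : nat).

Lemma trig_eval_sq_pow l n t x :
  trig_eval N 0 (sq_pow l n) t x = ((trig_eval N 0 l t x * Cconj (trig_eval N 0 l t x)) ^ n)%C.
Proof.
  induction n as [|n IH]; cbn [sq_pow Cpow].
  - cbn; unfold freq; rewrite Rmult_0_l, Rmult_0_l, cis_0; ring.
  - now rewrite !trig_eval_trig_mul, trig_eval_trig_conj, IH.
Qed.

Lemma trig_eval_sq_diff l d t x : let u := trig_eval N 0 l t x in let v := (trig_eval N 0 l t x +
  trig_eval N 0 d t x)%C in
  trig_eval N 0 (sq_diff l d) t x = (v * Cconj v - u * Cconj u)%C.
Proof.
  cbv zeta; unfold sq_diff; rewrite trig_eval_app, !trig_eval_trig_mul, !trig_eval_trig_conj,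
    trig_eval_app, Cplus_conj; ring.
Qed.

Lemma trig_eval_sq_pow_diff l d n t x : let u := trig_eval N 0 l t x in let v := (trig_eval N 0 l
  t x + trig_eval N 0 d t x)%C in
  trig_eval N 0 (sq_pow_diff l d n) t x = ((v * Cconj v) ^ n - (u * Cconj u) ^ n)%C.
Proof.
  cbv zeta; induction n as [|n IH]; cbn [sq_pow_diff Cpow].
  - cbn; ring.
  - rewrite trig_eval_app, !trig_eval_trig_mul, trig_eval_app, trig_eval_sq_diff,
    trig_eval_trig_mul, trig_eval_trig_conj, trig_eval_sq_pow, IH; ring.
Qed.

Lemma trig_eval_nonlin_diff q l d t x :
  trig_eval N 0 (nonlin_diff q l d) t x =
  (nonlin q (trig_eval N 0 l t x + trig_eval N 0 d t x) - nonlin q (trig_eval N 0 l t x))%C.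
Proof.
  unfold nonlin_diff, nonlin; rewrite trig_eval_app, !trig_eval_trig_mul, trig_eval_app,
    trig_eval_sq_pow_diff, trig_eval_sq_pow; ring.
Qed.
End Differences.

Lemma acont_sq_pow l n : Forall acont l -> Forall acont (sq_pow l n).
Proof.
  intros H; induction n; cbn.
  - constructor; [intros t; apply continuous_const|constructor].
  - auto using acont_trig_mul, acont_trig_conj.
Qed.

Lemma acont_app l1 l2 : Forall acont l1 -> Forall acont l2 -> Forall acont (l1 ++ l2).
Proof. intros; apply Forall_app; auto. Qed.

Lemma acont_nonlin_diff q l d : Forall acont l -> Forall acont d ->
  Forall acont (nonlin_diff q l d).
Proof.
  intros Hl Hd.
  assert (Forall acont (sq_diff l d)) by (unfold sq_diff; auto using acont_app, acont_trig_mul,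
    acont_trig_conj).
  assert (Forall acont (sq_pow_diff l d q)).
  { induction q; cbn; [constructor|].
    auto 7 using acont_app, acont_trig_mul, acont_trig_conj, acont_sq_pow. }
  unfold nonlin_diff; auto using acont_app, acont_trig_mul, acont_sq_pow.
Qed.

Lemma wnorm_trig_mul_le l1 l2 t a b : wnorm l1 t <= a -> wnorm l2 t <= b ->
  wnorm (trig_mul l1 l2) t <= a * b.
Proof.
  intros; eapply Rle_trans; [apply wnorm_trig_mul|].
  apply Rmult_le_compat; auto using wnorm_pos.
Qed.

(** [L] is obtained from [q] and [R0] alone; the frequency [N] does not occur, which is what allows
    it to be chosen last. *)
Lemma wnorm_nonlin_diff_bound q R0 : exists L, 0 < L /\ forall l d t,
  wnorm l t <= R0 -> wnorm d t <= R0 -> wnorm (nonlin_diff q l d) t <= L * wnorm d t.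
Proof.
  assert (Hp : forall n, exists A, 0 <= A /\ forall l t, wnorm l t <= R0 ->
    wnorm (sq_pow l n) t <= A).
  { induction n as [|n [A [HA IH]]].
    - exists (weight 0); split; [left; apply weight_pos|].
      intros l t _; cbn; rewrite Cmod_1; lra.
    - exists (Rabs R0 * Rabs R0 * A); split; [pose proof (Rabs_pos R0); nra|].
      intros l t Hl; cbn [sq_pow]; pose proof (Rle_abs R0).
      apply wnorm_trig_mul_le; [apply wnorm_trig_mul_le; rewrite ?wnorm_trig_conj; lra|auto]. }
  assert (Hs : forall l d t, wnorm l t <= R0 -> wnorm d t <= R0 ->
     wnorm (sq_diff l d) t <= 3 * Rabs R0 * wnorm d t).
  { intros l d t Hl Hd; pose proof (Rle_abs R0).
    unfold sq_diff; rewrite wnorm_app.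
    replace (3 * Rabs R0 * wnorm d t)
      with (wnorm d t * Rabs R0 + (2 * Rabs R0) * wnorm d t) by ring.
    apply Rplus_le_compat; apply wnorm_trig_mul_le; rewrite ?wnorm_trig_conj, ?wnorm_app; lra. }
  assert (Hd : forall n, exists B, 0 <= B /\ forall l d t, wnorm l t <= R0 -> wnorm d t <= R0 ->
     wnorm (sq_pow_diff l d n) t <= B * wnorm d t).
  { induction n as [|n [B [HB IH]]].
    - exists 0; split; [lra|]; intros; cbn; lra.
    - destruct (Hp n) as [A [HA HpA]].
      (* The factor [4 R0^2] bounds [|l|^2] together with its increment: [R0^2 + 3 R0^2]. *)
      exists (3 * Rabs R0 * A + 4 * (Rabs R0 * Rabs R0) * B); split; [pose proof (Rabs_pos R0);
        nra|].
      intros l d t Hl Hd; pose proof (Rle_abs R0); pose proof (Rabs_pos R0);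
      pose proof (wnorm_pos d t).
      cbn [sq_pow_diff]; rewrite wnorm_app.
      replace ((3 * Rabs R0 * A + 4 * (Rabs R0 * Rabs R0) * B) * wnorm d t)
        with ((3 * Rabs R0 * wnorm d t) * A + (4 * (Rabs R0 * Rabs R0)) * (B * wnorm d t)) by ring.
      apply Rplus_le_compat; apply wnorm_trig_mul_le; auto.
      rewrite wnorm_app.
      assert (wnorm (trig_mul l (trig_conj l)) t <= Rabs R0 * Rabs R0)
        by (apply wnorm_trig_mul_le; rewrite ?wnorm_trig_conj; lra).
      specialize (Hs l d t Hl Hd); nra. }
  destruct (Hp q) as [A [HA HpA]]; destruct (Hd q) as [B [HB HdB]].
  exists (B * Rabs R0 + A + B * Rabs R0 + 1); split; [pose proof (Rabs_pos R0); nra|].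
  intros l d t Hl Hdt; pose proof (Rle_abs R0); pose proof (wnorm_pos d t).
  unfold nonlin_diff; rewrite wnorm_app.
  assert (wnorm (trig_mul (sq_pow_diff l d q) l) t <= B * wnorm d t * Rabs R0)
    by (apply wnorm_trig_mul_le; [auto|lra]).
  assert (wnorm (trig_mul (sq_pow l q ++ sq_pow_diff l d q) d) t <= (A + B * Rabs R0) * wnorm d t).
  { apply wnorm_trig_mul_le; [|lra].
    rewrite wnorm_app; apply Rplus_le_compat; [auto|].
    eapply Rle_trans; [apply HdB; auto|apply Rmult_le_compat_l; lra]. }
  nra.
Qed.

(** * The Picard iteration *)

(** Identities between trigonometric polynomials are easy at order 0, where [trig_mul] is a product;
    uniqueness of derivatives carries them to every order. *)
Lemma derivatives_chain (f g : nat -> R -> C) :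
  (forall i x, is_derive_C (f i) x (f (S i) x)) ->
  (forall i x, is_derive_C (g i) x (g (S i) x)) ->
  (forall x, f 0%nat x = g 0%nat x) -> forall i x, f i x = g i x.
Proof.
  intros Hf Hg H0 i; induction i as [|i IH]; intros x; [apply H0|].
  apply (is_derive_C_unique (f i) x _ _ (Hf i x)).
  eapply is_derive_C_ext; [intros y; symmetry; apply IH|apply Hg].
Qed.

Lemma eval_iter_deriv_x_DAdd V i e1 e2 t x :
  eval V (Nat.iter i deriv_x (DAdd e1 e2)) t x =
  (eval V (Nat.iter i deriv_x e1) t x + eval V (Nat.iter i deriv_x e2) t x)%C.
Proof.
  revert e1 e2; induction i as [|i IH]; intros e1 e2; [reflexivity|].
  rewrite !Nat.iter_succ_r; apply IH.
Qed.

Lemma eval_iter_deriv_x_DCst V i c e t x :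
  eval V (Nat.iter i deriv_x (DMul (DCst c) e)) t x = (c * eval V (Nat.iter i deriv_x e) t x)%C.
Proof.
  revert c e; induction i as [|i IH]; intros c e; [reflexivity|].
  rewrite !Nat.iter_succ_r; cbn [deriv_x]; rewrite eval_iter_deriv_x_DAdd, !IH; ring.
Qed.

Lemma eval_iter_deriv_x_rhs V omega q i t x :
  eval V (Nat.iter i deriv_x (nls_rhs omega q)) t x =
  (- Ci * V (S (S i)) t x + RtoC omega * Ci * eval V (Nat.iter i deriv_x (Fexpr q)) t x)%C.
Proof.
  unfold nls_rhs; rewrite eval_iter_deriv_x_DAdd, !eval_iter_deriv_x_DCst; do 2 f_equal.
  replace (Nat.iter i deriv_x (DVar 2)) with (DVar (S (S i))); [reflexivity|].
  induction i as [|i IH]; [reflexivity|]; rewrite Nat.iter_succ; now rewrite <- IH.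
Qed.

Lemma Clim_ext (f g : nat -> C) : (forall n, f n = g n) -> Clim f = Clim g.
Proof.
  intros H; unfold Clim; f_equal; f_equal; apply Lim_seq_ext; intros n; now rewrite H.
Qed.

Lemma Clim_const (c : C) : Clim (fun _ => c) = c.
Proof. unfold Clim; rewrite !Lim_seq_const; now destruct c. Qed.

Section Evolution.
Variables (N q : nat) (omega : R).
Hypothesis Homega : Rabs omega = 1.

Definition eval_at_trig (l : list atom) (e : diffpoly) (t x : R) : C :=
  eval (fun i => trig_eval N i l) e t x.

Lemma trig_eval_of_nonlin l l1 l2 t :
  (forall x, trig_eval N 0 l t x = (nonlin q (trig_eval N 0 l2 t x) - nonlin q (trig_eval N 0 l1
    t x))%C) ->
  forall i x, trig_eval N i l t x =
   (eval_at_trig l2 (Nat.iter i deriv_x (Fexpr q)) t x - eval_at_trig l1 (Nat.iter i deriv_x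
     (Fexpr q)) t x)%C.
Proof.
  intros H.
  assert (He : forall l i x, is_derive_C (eval_at_trig l (Nat.iter i deriv_x (Fexpr q)) t) x
     (eval_at_trig l (Nat.iter (S i) deriv_x (Fexpr q)) t x)).
  { intros; apply eval_derive_x; intros; apply trig_eval_derive_x. }
  apply (derivatives_chain (fun i => trig_eval N i l t) (fun i x =>
   (eval_at_trig l2 (Nat.iter i deriv_x (Fexpr q)) t x - eval_at_trig l1 (Nat.iter i deriv_x
     (Fexpr q)) t x)%C)).
  - intros; apply trig_eval_derive_x.
  - intros i x.
    apply (is_derive_minus (K := R_AbsRing) (V := CR)); apply He.
  - intros x; rewrite H; cbn [Nat.iter nat_rect]; unfold eval_at_trig; now rewrite !eval_Fexpr.
Qed.

Variables (z zres znr : list atom).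

(** The state holds an iterate and the increment to the next one. Building the increment from
    [nonlin_diff], rather than subtracting two Duhamel integrals, keeps it visibly proportional to
    the previous increment. *)
Fixpoint picard (n : nat) : list atom * list atom :=
  match n with
  | O => (z, duhamel N omega znr)
  | S n' => let (u, d) := picard n' in (u ++ d, duhamel N omega (nonlin_diff q u d))
  end.

Definition picard_sum n := fst (picard n).
Definition picard_incr n := snd (picard n).

Lemma picard_sum_S n : picard_sum (S n) = picard_sum n ++ picard_incr n.
Proof. unfold picard_sum, picard_incr; cbn; now destruct (picard n). Qed.

Lemma picard_incr_S n : picard_incr (S n) =
  duhamel N omega (nonlin_diff q (picard_sum n) (picard_incr n)).
Proof. unfold picard_sum, picard_incr; cbn; now destruct (picard n). Qed.

(** The candidate for the [i]-th [x]-derivative of the solution, each order being given its own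
    limit; uniform convergence will show that these are derivatives of one another. *)
Definition mode (i : nat) (t x : R) : C := Clim (fun n => trig_eval N i (picard_sum n) t x).

Hypothesis Hz : Forall acont z.
Hypothesis Hznr : Forall acont znr.

Lemma acont_picard n : Forall acont (picard_sum n) /\ Forall acont (picard_incr n).
Proof.
  induction n as [|n [IH1 IH2]].
  - split; [exact Hz|]; now apply acont_duhamel.
  - rewrite picard_sum_S, picard_incr_S; split; [now apply acont_app|].
    apply acont_duhamel; now apply acont_nonlin_diff.
Qed.

(** All increments are Duhamel integrals and vanish at time 0, so the data of the ansatz are
    attained exactly and not just up to the approximation error. *)
Lemma mode_initial x : mode 0 0 x = trig_eval N 0 z 0 x.
Proof.
  unfold mode; rewrite <- (Clim_const (trig_eval N 0 z 0 x)); apply Clim_ext; intros n.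
  induction n as [|n IH]; [reflexivity|].
  rewrite picard_sum_S, trig_eval_app, IH.
  replace (trig_eval N 0 (picard_incr n) 0 x) with (RtoC 0); [ring|].
  destruct n; [cbn|rewrite picard_incr_S]; symmetry; apply trig_eval_duh_0.
Qed.

Lemma mode_periodic t x : mode 0 t (x + 2 * PI) = mode 0 t x.
Proof. apply Clim_ext; intros n; apply trig_eval_periodic. Qed.

(** The starting point [z] solves the equation with the nonlinearity replaced by its resonant part
    [zres]; the defect [znr] feeds the first increment. *)
Hypothesis Hzt : forall i t x, is_derive_C (fun t => trig_eval N i z t x) t
  (- Ci * trig_eval N (S (S i)) z t x + RtoC omega * Ci * trig_eval N i zres t x)%C.
Hypothesis Hsplit : forall t x,
  (trig_eval N 0 zres t x + trig_eval N 0 znr t x)%C = nonlin q (trig_eval N 0 z t x).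

(** The sources telescope: [zres] and [znr] add up to [F (u_0)], and each later increment adds
    [F (u_(n+1)) - F (u_n)]. *)
Lemma picard_equation n i t x :
  is_derive_C (fun t => trig_eval N i (picard_sum (S n)) t x) t
   (- Ci * trig_eval N (S (S i)) (picard_sum (S n)) t x
    + RtoC omega * Ci * eval_at_trig (picard_sum n) (Nat.iter i deriv_x (Fexpr q)) t x)%C.
Proof.
  induction n as [|n IH].
  - rewrite picard_sum_S.
    replace (eval_at_trig (picard_sum 0) (Nat.iter i deriv_x (Fexpr q)) t x)
      with (trig_eval N i zres t x + trig_eval N i znr t x)%C.
    2: { rewrite <- trig_eval_app.
         apply (derivatives_chain (fun i => trig_eval N i (zres ++ znr) t)
           (fun i => eval_at_trig (picard_sum 0) (Nat.iter i deriv_x (Fexpr q)) t)).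
         - intros; apply trig_eval_derive_x.
         - intros; apply eval_derive_x; intros; apply trig_eval_derive_x.
         - intros y; cbn [Nat.iter nat_rect]; unfold eval_at_trig.
           rewrite eval_Fexpr, trig_eval_app; apply Hsplit. }
    apply is_derive_C_ext with (fun t => trig_eval N i z t x + trig_eval N i (duhamel N omega
      znr) t x)%C.
    { intros; symmetry; apply trig_eval_app. }
    rewrite trig_eval_app.
    pose proof (is_derive_C_plus _ _ t _ _ (Hzt i t x) (trig_eval_duh_derive N omega i znr t x
      Hznr)) as H.
    match type of H with is_derive_C _ _ ?l => match goal with |- is_derive_C _ _ ?l' =>
      replace l' with l; [exact H|] end end.
    cbn [picard_sum picard_incr picard fst snd]; ring.
  - destruct (acont_picard n) as [Hu Hd].
    rewrite (picard_sum_S (S n)).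
    apply is_derive_C_ext with (fun t => trig_eval N i (picard_sum (S n)) t x + trig_eval N i
      (picard_incr (S n)) t x)%C.
    { intros; symmetry; apply trig_eval_app. }
    rewrite trig_eval_app.
    pose proof (is_derive_C_plus _ _ t _ _ IH
      (trig_eval_duh_derive N omega i (nonlin_diff q (picard_sum n) (picard_incr n)) t x
        (acont_nonlin_diff _ _ _ Hu Hd))) as H.
    rewrite (trig_eval_of_nonlin (nonlin_diff q (picard_sum n) (picard_incr n)) (picard_sum n)
      (picard_sum (S n))) in H.
    2: { intros y; rewrite picard_sum_S, trig_eval_app; apply trig_eval_nonlin_diff. }
    rewrite picard_incr_S.
    match type of H with is_derive_C _ _ ?l => match goal with |- is_derive_C _ _ ?l' =>
      replace l' with l; [exact H|] end end.
    ring.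
Qed.

Variables (T R0 L eps : R).
Hypothesis HT : 0 < T.
Hypothesis HL : 0 < L.
Hypothesis Heps : 0 <= eps.
Hypothesis Heps1 : 2 * (eps * exp (2 * L * T)) <= 1.
Hypothesis HR0 : 0 <= R0.
Hypothesis HzR : forall t, wnorm z t <= R0.
Hypothesis Hd0 : forall t, wnorm (duhamel N omega znr) t <= eps.
Hypothesis HdF : forall l d t,
  wnorm l t <= R0 + 1 -> wnorm d t <= R0 + 1 -> wnorm (nonlin_diff q l d) t <= L * wnorm d t.

(** The two bounds support each other. The increments sum to at most [2 eps exp (2 L T) <= 1], so
    the iterates stay in the ball of radius [R0 + 1], where [L] is valid; and there the weight
    [exp (2 L |t|)] makes each Duhamel step halve the increment. *)
Lemma picard_bound n t : Rabs t < T ->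
  wnorm (picard_incr n) t <= eps * (/ 2) ^ n * exp (2 * L * Rabs t) /\
  wnorm (picard_sum n) t <= R0 + 2 * (eps * exp (2 * L * T)) * (1 - (/ 2) ^ n).
Proof.
  assert (HE : forall t, Rabs t < T -> 1 <= exp (2 * L * Rabs t) <= exp (2 * L * T)).
  { intros s Hs; pose proof (Rabs_pos s); split.
    - rewrite <- exp_0; destruct (Req_dec (Rabs s) 0) as [E|E].
      + rewrite E, Rmult_0_r; lra.
      + left; apply exp_increasing; nra.
    - left; apply exp_increasing; nra. }
  revert t; induction n as [|n IH]; intros t Ht.
  - cbn [pow]; split.
    + eapply Rle_trans; [apply Hd0|]; specialize (HE t Ht); nra.
    + eapply Rle_trans; [apply HzR|]; lra.
  - pose proof (pow_half_pos n) as Hn; pose proof (pow_half_le1 n) as Hn1.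
    destruct (IH t Ht) as [IHd IHu].
    assert (0 <= eps * (/ 2) ^ n) by nra.
    assert (Hdn : wnorm (picard_incr n) t <= eps * exp (2 * L * T) * (/ 2) ^ n).
    { eapply Rle_trans; [exact IHd|]; specialize (HE t Ht); nra. }
    split.
    + rewrite picard_incr_S.
      destruct (acont_picard n) as [Hu Hd].
      eapply Rle_trans; [apply wnorm_duhamel_RInt; [exact Homega|now apply acont_nonlin_diff]|].
      eapply Rle_trans.
      * apply (RInt_exp_bound _ (L * (eps * (/ 2) ^ n)) (2 * L)); [nra|lra| |].
        { intros; now apply wnorm_continuous, acont_nonlin_diff. }
        intros s Hs; destruct (IH s) as [Is Iu]; [lra|].
        assert (Hs' : Rabs s < T) by lra.
        specialize (HE s Hs').
        assert (wnorm (picard_incr n) s <= eps * exp (2 * L * T)).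
        { eapply Rle_trans; [exact Is|].
          assert (eps * (/ 2) ^ n <= eps) by nra; nra. }
        eapply Rle_trans; [apply HdF|].
        -- nra.
        -- lra.
        -- rewrite Rmult_assoc; apply Rmult_le_compat_l; lra.
      * right; cbn [pow]; field; lra.
    + rewrite picard_sum_S, wnorm_app; cbn [pow]; lra.
Qed.

Definition strip (y : R * R) : Prop := Rabs (fst y) < T.

Lemma mode_increment i n t x : Rabs t < T ->
  Cmod (trig_eval N i (picard_sum (S n)) t x - trig_eval N i (picard_sum n) t x)%C <=
  INR N ^ i * INR (fact i) * (eps * exp (2 * L * T)) * (/ 2) ^ n.
Proof.
  intros Ht; rewrite picard_sum_S, trig_eval_app.
  replace (trig_eval N i (picard_sum n) t x + trig_eval N i (picard_incr n) t x - trig_eval N i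
    (picard_sum n) t x)%C
    with (trig_eval N i (picard_incr n) t x) by ring.
  eapply Rle_trans; [apply trig_eval_bound|].
  rewrite (Rmult_assoc (INR N ^ i * INR (fact i))).
  apply Rmult_le_compat_l.
  { apply Rmult_le_pos; [apply pow_le, pos_INR|apply pos_INR]. }
  destruct (picard_bound n t Ht) as [Hd _].
  eapply Rle_trans; [exact Hd|].
  pose proof (pow_half_pos n).
  replace (eps * exp (2 * L * T) * (/ 2) ^ n) with (eps * (/ 2) ^ n * exp (2 * L * T)) by ring.
  apply Rmult_le_compat_l; [nra|].
  left; apply exp_increasing; nra.
Qed.

Lemma mode_bound i n t x : Rabs t < T ->
  Cmod (trig_eval N i (picard_sum n) t x - mode i t x)%C <=
  4 * (INR N ^ i * INR (fact i) * (eps * exp (2 * L * T))) * (/ 2) ^ n.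
Proof.
  intros Ht; apply (Clim_geometric (fun n => trig_eval N i (picard_sum n) t x)).
  intros k; now apply mode_increment.
Qed.

Lemma mode_unif_cv i :
  unif_cv strip (fun n y => trig_eval N i (picard_sum n) (fst y) (snd y)) (fun y => mode i (fst
    y) (snd y)).
Proof. eexists; intros n [t x] Hy; now apply mode_bound. Qed.

Lemma mode_unif_bounded i : unif_bounded strip (fun y => mode i (fst y) (snd y)).
Proof.
  apply (unif_bounded_unif_cv strip (fun n y => trig_eval N i (picard_sum n) (fst y) (snd y)));
    [|apply mode_unif_cv].
  exists (INR N ^ i * INR (fact i) * R0); intros [t x] _; cbn [fst snd].
  eapply Rle_trans; [apply trig_eval_bound|].
  apply Rmult_le_compat_l; [|apply HzR].
  apply Rmult_le_pos; [apply pow_le, pos_INR|apply pos_INR].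
Qed.

Lemma mode_derive_x i t x : Rabs t < T -> is_derive_C (mode i t) x (mode (S i) t x).
Proof.
  intros Ht.
  assert (Hr : forall y, Boule x (mkposreal 1 Rlt_0_1) y -> strip (t, y)) by (intros; exact Ht).
  apply (unif_cv_derive (fun n y => trig_eval N i (picard_sum n) t y) (fun n y => trig_eval N (S
    i) (picard_sum n) t y)
     (mode i t) (mode (S i) t) x (mkposreal 1 Rlt_0_1)).
  - apply (unif_cv_subset strip _ (fun y => (t, y)) _ _ Hr (mode_unif_cv i)).
  - apply (unif_cv_subset strip _ (fun y => (t, y)) _ _ Hr (mode_unif_cv (S i))).
  - intros; apply trig_eval_derive_x.
  - intros n y _; eapply is_derive_C_continuous, trig_eval_derive_x.
  - unfold Boule; rewrite Rminus_diag, Rabs_R0; cbn; lra.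
Qed.

Lemma unif_cv_shift {A : Type} (S : A -> Prop) fn f :
  unif_cv S fn f -> unif_cv S (fun n => fn (Datatypes.S n)) f.
Proof.
  intros [K HK]; exists (K * / 2); intros n x Hx.
  specialize (HK (Datatypes.S n) x Hx); cbn [pow] in HK; lra.
Qed.

Lemma mode_derive_t i t x : Rabs t < T ->
  is_derive_C (fun t' => mode i t' x) t (eval mode (Nat.iter i deriv_x (nls_rhs omega q)) t x).
Proof.
  intros Ht.
  assert (Hr : forall y, Boule 0 (mkposreal T HT) y -> strip (y, x)).
  { intros y Hy; unfold Boule in Hy; rewrite Rminus_0_r in Hy; exact Hy. }
  apply (unif_cv_derive (fun n t' => trig_eval N i (picard_sum (S n)) t' x)
    (fun n t' => (- Ci * trig_eval N (S (S i)) (picard_sum (S n)) t' x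
      + RtoC omega * Ci * eval_at_trig (picard_sum n) (Nat.iter i deriv_x (Fexpr q)) t' x)%C)
     (fun t' => mode i t' x) (fun t' => eval mode (Nat.iter i deriv_x (nls_rhs omega q)) t' x)
     0 (mkposreal T HT)).
  (* The iterate [n + 1] is driven by the nonlinearity at the iterate [n], hence the shifted
     sequences. *)
  - apply (unif_cv_shift _ (fun n t' => trig_eval N i (picard_sum n) t' x)).
    apply (unif_cv_subset strip _ (fun y => (y, x)) _ _ Hr (mode_unif_cv i)).
  - assert (H : unif_cv (Boule 0 (mkposreal T HT))
      (fun n t' => (- Ci * trig_eval N (S (S i)) (picard_sum (S n)) t' x
      + RtoC omega * Ci * eval_at_trig (picard_sum n) (Nat.iter i deriv_x (Fexpr q)) t' x)%C)
      (fun t' => (- Ci * mode (S (S i)) t' x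
      + RtoC omega * Ci * eval mode (Nat.iter i deriv_x (Fexpr q)) t' x)%C)).
    { apply (unif_cv_plus _ (fun n t' => - Ci * trig_eval N (S (S i)) (picard_sum (S n)) t' x)%C).
      - apply (unif_cv_mult _ (fun _ _ => (- Ci)%C) _ (fun n t' => trig_eval N (S (S i))
        (picard_sum (S n)) t' x)).
        + apply unif_bounded_const.
        + destruct (mode_unif_bounded (S (S i))) as [M HM]; exists M; intros y Hy; apply (HM (y,
          x)); auto.
        + apply unif_cv_const.
        + apply (unif_cv_shift _ (fun n t' => trig_eval N (S (S i)) (picard_sum n) t' x)).
          apply (unif_cv_subset strip _ (fun y => (y, x)) _ _ Hr (mode_unif_cv (S (S i)))).
      - apply (unif_cv_mult _ (fun _ _ => (RtoC omega * Ci)%C)).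
        + apply unif_bounded_const.
        + destruct (eval_unif_bounded strip fst snd mode mode_unif_bounded (Nat.iter i deriv_x
          (Fexpr q))) as [M HM].
          exists M; intros y Hy; apply (HM (y, x)); auto.
        + apply unif_cv_const.
        + apply (unif_cv_subset strip _ (fun y => (y, x)) _ _ Hr
            (eval_unif_cv strip fst snd (fun n i => trig_eval N i (picard_sum n)) mode
              mode_unif_bounded mode_unif_cv
              (Nat.iter i deriv_x (Fexpr q)))). }
    destruct H as [K HK]; exists K; intros n y Hy; rewrite eval_iter_deriv_x_rhs; auto.
  - intros; apply picard_equation.
  - intros n y _; apply continuous_C_plus; apply continuous_C_mult; try apply continuous_const.
    + apply trig_eval_continuous; [apply acont_picard|apply continuous_id|apply continuous_const].
    + apply (eval_continuous (fun i => trig_eval N i (picard_sum n)) (fun y => y) (fun _ => x));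
      intros j.
      apply trig_eval_continuous; [apply acont_picard|apply continuous_id|apply continuous_const].
  - unfold Boule; rewrite Rminus_0_r; exact Ht.
Qed.

Lemma mode_continuous i t x : Rabs t < T ->
  continuous_C (fun y : R * R => mode i (fst y) (snd y)) (t, x).
Proof.
  intros Ht.
  apply (unif_cv_continuous (T := prod_UniformSpace R_UniformSpace R_UniformSpace) strip
    (fun n y => trig_eval N i (picard_sum n) (fst y) (snd y))); [|exact Ht|apply mode_unif_cv|].
  - assert (Hr : 0 < T - Rabs t) by lra.
    exists (mkposreal _ Hr); intros [t' x'] [Hy _].
    change (Rabs (t' - t) < T - Rabs t) in Hy; unfold strip; cbn.
    replace t' with ((t' - t) + t) by ring.
    eapply Rle_lt_trans; [apply Rabs_triang|lra].
  - intros n; apply trig_eval_continuous; [apply acont_picard|apply continuous_fst|apply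
    continuous_snd].
Qed.

Lemma evolution delta : delta < T -> smooth_NLS_solution omega (2 * q + 1) delta (mode 0).
Proof.
  intros Hd; apply (smooth_NLS_of_modes omega T delta q mode Hd).
  - intros; now apply mode_derive_x.
  - intros; now apply mode_derive_t.
  - intros; now apply mode_continuous.
  - intros; apply mode_periodic.
Qed.

(** The ansatz is the iterate of index 0, so this is the convergence rate read at [n = 0]. *)
Lemma mode_close t x : Rabs t < T ->
  Cmod (mode 0 t x - trig_eval N 0 z t x)%C <= 4 * (eps * exp (2 * L * T)).
Proof.
  intros Ht.
  rewrite <- Cmod_opp.
  replace (- (mode 0 t x - trig_eval N 0 z t x))%C with (trig_eval N 0 (picard_sum 0) t x - mode
    0 t x)%C by (cbn; ring).
  eapply Rle_trans; [now apply mode_bound|]; cbn; lra.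
Qed.
End Evolution.

(** * The two-mode approximate solution *)

Fixpoint laurent_eval (L : list (Z * R)) (y : R) : C :=
  match L with
  | [] => 0%C
  | (k, c) :: L' => (RtoC c * cis (IZR k * y) + laurent_eval L' y)%C
  end.

Fixpoint coef (L : list (Z * R)) (k : Z) : R :=
  match L with
  | [] => 0
  | (j, c) :: L' => (if Z.eq_dec j k then c else 0) + coef L' k
  end.

Definition mul_monomial (j : Z) (r : R) (L : list (Z * R)) : list (Z * R) :=
  map (fun m => ((fst m + j)%Z, r * snd m)) L.

(* The Laurent expansion of [|a + b E|^(2 q) (a + b E)] in [E = exp (i y)]. *)
Fixpoint laurent (a b : R) (q : nat) : list (Z * R) :=
  match q with
  | O => [(0%Z, a); (1%Z, b)]
  | S q' => let L := laurent a b q' in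
      mul_monomial 0 (a ^ 2 + b ^ 2) L ++ mul_monomial 1 (a * b) L ++ mul_monomial (-1) (a * b) L
  end.

Lemma laurent_eval_app L1 L2 y :
  laurent_eval (L1 ++ L2) y = (laurent_eval L1 y + laurent_eval L2 y)%C.
Proof. induction L1 as [|[k c] L IH]; cbn; [ring|rewrite IH; ring]. Qed.

Lemma laurent_eval_mul j r L y :
  laurent_eval (mul_monomial j r L) y = (RtoC r * cis (IZR j * y) * laurent_eval L y)%C.
Proof.
  induction L as [|[k c] L IH]; cbn; [ring|].
  fold (mul_monomial j r L); rewrite IH, plus_IZR, Rmult_plus_distr_r, cis_plus, RtoC_mult; ring.
Qed.

Lemma coef_app L1 L2 k : coef (L1 ++ L2) k = coef L1 k + coef L2 k.
Proof. induction L1 as [|[j c] L IH]; cbn; [ring|rewrite IH; ring]. Qed.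

Lemma coef_mul j r L k : coef (mul_monomial j r L) k = r * coef L (k - j).
Proof.
  induction L as [|[i c] L IH]; cbn; [ring|].
  fold (mul_monomial j r L); rewrite IH.
  destruct (Z.eq_dec (i + j) k), (Z.eq_dec i (k - j)); try lia; ring.
Qed.

Lemma laurent_eval_nonlin a b q y :
  laurent_eval (laurent a b q) y = nonlin q (RtoC a + RtoC b * cis y)%C.
Proof.
  unfold nonlin; induction q as [|q IH].
  - cbn; rewrite Rmult_0_l, Rmult_1_l, cis_0; ring.
  - cbn [laurent]; rewrite !laurent_eval_app, !laurent_eval_mul, IH.
    cbn [Cpow].
    set (P := (((RtoC a + RtoC b * cis y) * Cconj (RtoC a + RtoC b * cis y)) ^ q)%C).
    (* The factor [cis y * Cconj (cis y) = 1] is inserted so that [ring] can match the expansion of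
       [|a + b E|^2]. *)
    replace (RtoC (a ^ 2 + b ^ 2) * cis (0 * y))%C with (RtoC a * RtoC a + RtoC b * RtoC b * (cis
      y * Cconj (cis y)))%C.
    + rewrite Rmult_1_l.
      replace (IZR (-1) * y) with (- y) by (cbn; ring).
      rewrite cis_opp, Cplus_conj, Cmult_conj, RtoC_mult.
      replace (Cconj (RtoC a)) with (RtoC a) by (apply injective_projections; cbn; ring).
      replace (Cconj (RtoC b)) with (RtoC b) by (apply injective_projections; cbn; ring).
      ring.
    + rewrite Rmult_0_l, cis_0, <- cis_opp, <- cis_plus, Rplus_opp_r, cis_0.
      rewrite <- !RtoC_mult, <- RtoC_plus; f_equal; ring.
Qed.

(** The term [E^k] turns in time at about [k N^2], the free flow at that frequency at [(k N)^2]; the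
    leading orders agree exactly when [k^2 = k]. *)
Definition nonres (k : Z) : bool := negb (Z.eqb k 0) && negb (Z.eqb k 1).

Lemma laurent_eval_split L y :
  laurent_eval L y = (RtoC (coef L 0) + RtoC (coef L 1) * cis y
    + laurent_eval (filter (fun m => nonres (fst m)) L) y)%C.
Proof.
  induction L as [|[k c] L IH]; [cbn; ring|].
  cbn [laurent_eval coef filter fst]; rewrite IH, !RtoC_plus.
  unfold nonres at 2.
  destruct (Z.eqb_spec k 0) as [->|H0]; [|destruct (Z.eqb_spec k 1) as [->|H1]]; cbn [negb andb].
  - destruct (Z.eq_dec 0 0), (Z.eq_dec 0 1); try lia; rewrite Rmult_0_l, cis_0; ring.
  - destruct (Z.eq_dec 1 0), (Z.eq_dec 1 1); try lia; rewrite Rmult_1_l; ring.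
  - destruct (Z.eq_dec k 0), (Z.eq_dec k 1); try lia; cbn [laurent_eval]; ring.
Qed.

(* The [E^k] coefficient of [laurent a b q] is [a^|k-1|] times a polynomial in
   [A = a^2] and [b] with nonnegative coefficients, namely this one. *)
Fixpoint reduced_coef (A b : R) (q : nat) (k : Z) : R :=
  match q with
  | O => if Z.eq_dec k 0 then 1 else if Z.eq_dec k 1 then b else 0
  | S q' =>
      (A + b ^ 2) * reduced_coef A b q' k +
      b * ((if Z_lt_dec k 2 then A else 1) * reduced_coef A b q' (k - 1) +
           (if Z_lt_dec k 1 then 1 else A) * reduced_coef A b q' (k + 1))
  end.

(** A shift by one comes with a factor [a] and changes the distance [|k - 1|] by one. Coming from a
    nearer neighbour, that factor supplies the missing power; coming from a farther one, it leaves a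
    surplus [a^2], which is the [A] in the recursion. At [k = 1] both neighbours are farther. *)
Lemma coef_laurent a b q k :
  coef (laurent a b q) k = a ^ Z.abs_nat (k - 1) * reduced_coef (a ^ 2) b q k.
Proof.
  revert k; induction q as [|q IH]; intros k.
  - cbn [laurent coef reduced_coef].
    destruct (Z.eq_dec 0 k), (Z.eq_dec 1 k), (Z.eq_dec k 0), (Z.eq_dec k 1); try lia; subst;
    try change (Z.abs_nat (0 - 1)) with 1%nat; try change (Z.abs_nat (1 - 1)) with 0%nat; ring.
  - cbn [laurent reduced_coef]; rewrite !coef_app, !coef_mul, !IH.
    replace (k - 0)%Z with k by lia; replace (k - -1)%Z with (k + 1)%Z by lia.
    destruct (Z_lt_dec k 1) as [H1|H1]; [|destruct (Z.eq_dec k 1) as [->|H2]].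
    + destruct (Z_lt_dec k 2); [|lia].
      replace (Z.abs_nat (k - 1 - 1)) with (S (Z.abs_nat (k - 1))) by lia.
      replace (Z.abs_nat (k - 1)) with (S (Z.abs_nat (k + 1 - 1))) by lia.
      cbn [pow]; ring.
    + change (Z.abs_nat (1 - 1)) with 0%nat; change (Z.abs_nat (1 - 1 - 1)) with 1%nat;
      change (Z.abs_nat (1 + 1 - 1)) with 1%nat.
      destruct (Z_lt_dec 1 2); [ring|lia].
    + destruct (Z_lt_dec k 2); [lia|].
      replace (Z.abs_nat (k + 1 - 1)) with (S (S (Z.abs_nat (k - 1 - 1)))) by lia.
      replace (Z.abs_nat (k - 1)) with (S (Z.abs_nat (k - 1 - 1))) by lia.
      cbn [pow]; ring.
Qed.

Lemma reduced_coef_mono A1 A2 b q k : 0 <= A2 <= A1 -> 0 <= b ->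
  0 <= reduced_coef A2 b q k <= reduced_coef A1 b q k.
Proof.
  intros HA Hb; revert k; induction q as [|q IH]; intros k; cbn [reduced_coef].
  - destruct (Z.eq_dec k 0), (Z.eq_dec k 1); lra.
  - pose proof (IH k) as H0; pose proof (IH (k - 1)%Z) as H1; pose proof (IH (k + 1)%Z) as H2.
    assert (Hmul : forall x1 x2 y1 y2, 0 <= x2 <= x1 -> 0 <= y2 <= y1 -> 0 <= x2 * y2 <= x1 * y1).
    { intros; split; [apply Rmult_le_pos|apply Rmult_le_compat]; lra. }
    assert (Hadd : forall x1 x2 y1 y2, 0 <= x2 <= x1 -> 0 <= y2 <= y1 -> 0 <= x2 + y2 <= x1 + y1).
    { intros; lra. }
    pose proof (pow2_ge_0 b).
    apply Hadd; [apply Hmul; [lra|exact H0]|].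
    apply Hmul; [lra|].
    apply Hadd; apply Hmul; auto; [destruct (Z_lt_dec k 2)|destruct (Z_lt_dec k 1)]; lra.
Qed.

(** For [q = 1] the gap is exactly [A1 - A2]. Each further power of [|a + b E|^2] multiplies it by
    at least [b^2], through the constant term [A + b^2], while all other terms are nondecreasing in
    [A]. *)
Lemma reduced_coef_gap A1 A2 b q : 0 <= A2 <= A1 -> 1 <= b -> (2 <= q)%nat ->
  (A1 - A2) * b <= reduced_coef A1 b q 0 - reduced_coef A2 b q 0.
Proof.
  intros HA Hb Hq.
  destruct q as [|[|q]]; try lia.
  enough (H : forall n, (A1 - A2) * b ^ (2 * n) <=
    reduced_coef A1 b (S n) 0 - reduced_coef A2 b (S n) 0).
  { eapply Rle_trans; [|apply H].
    apply Rmult_le_compat_l; [lra|].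
    replace (2 * S q)%nat with (S (S (2 * q))) by lia.
    cbn [pow]; pose proof (pow_R1_Rle b (2 * q) Hb); nra. }
  induction n as [|n IH].
  - cbn; lra.
  - remember (S n) as m; cbn [reduced_coef].
    destruct (Z_lt_dec 0 2), (Z_lt_dec 0 1); try lia.
    pose proof (reduced_coef_mono A1 A2 b m 0 HA ltac:(lra)).
    pose proof (reduced_coef_mono A1 A2 b m (0 - 1) HA ltac:(lra)).
    pose proof (reduced_coef_mono A1 A2 b m (0 + 1) HA ltac:(lra)).
    assert (A2 * reduced_coef A2 b m (0 - 1) <= A1 * reduced_coef A1 b m (0 - 1))
      by (apply Rmult_le_compat; lra).
    assert (A2 * reduced_coef A2 b m 0 <= A1 * reduced_coef A1 b m 0)
      by (apply Rmult_le_compat; lra).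
    assert (0 <= b * (A1 * reduced_coef A1 b m (0 - 1) + 1 * reduced_coef A1 b m (0 + 1)
      - (A2 * reduced_coef A2 b m (0 - 1) + 1 * reduced_coef A2 b m (0 + 1)))).
    { apply Rmult_le_pos; lra. }
    subst m.
    replace (2 * S n)%nat with (S (S (2 * n))) by lia; cbn [pow].
    apply Rmult_le_compat_l with (r := b ^ 2) in IH; [|apply pow2_ge_0].
    cbn [pow] in *; lra.
Qed.

Lemma CInt_cis (m t : R) : m <> 0 ->
  CInt (fun s => cis (m * s)) t = (RtoC (/ m) * - Ci * (cis (m * t) - 1))%C.
Proof.
  intros Hm; unfold CInt, cis; cbn [fst snd].
  apply injective_projections; cbn [fst snd].
  - transitivity (/ m * sin (m * t) - / m * sin (m * 0)).
    + apply is_RInt_unique.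
      apply (is_RInt_derive (V := R_CompleteNormedModule) (fun s => / m * sin (m * s))).
      * intros x _; auto_derive; [trivial|field; lra].
      * intros x _; apply (ex_derive_continuous (K := R_AbsRing) (V := R_NormedModule));
        auto_derive; trivial.
    + cbn; rewrite Rmult_0_r, sin_0; ring.
  - transitivity (- / m * cos (m * t) - - / m * cos (m * 0)).
    + apply is_RInt_unique.
      apply (is_RInt_derive (V := R_CompleteNormedModule) (fun s => - / m * cos (m * s))).
      * intros x _; auto_derive; [trivial|field; lra].
      * intros x _; apply (ex_derive_continuous (K := R_AbsRing) (V := R_NormedModule));
        auto_derive; trivial.
    + cbn; rewrite Rmult_0_r, cos_0; ring.
Qed.

Lemma CInt_cis_bound (m t : R) : m <> 0 -> Cmod (CInt (fun s => cis (m * s)) t) <= 2 / Rabs m.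
Proof.
  intros Hm; rewrite CInt_cis by exact Hm.
  rewrite !Cmod_mult, Cmod_opp, Cmod_Ci, Cmod_R, Rabs_inv.
  replace (2 / Rabs m) with (/ Rabs m * 1 * 2) by (unfold Rdiv; ring).
  apply Rmult_le_compat_l.
  { rewrite Rmult_1_r; left; apply Rinv_0_lt_compat, Rabs_pos_lt, Hm. }
  eapply Rle_trans; [apply Cmod_triangle|].
  rewrite Cmod_opp, Cmod_cis, Cmod_1; lra.
Qed.

(** * The ansatz and its non-resonant error *)

Section Ansatz.
Variables (N q : nat) (omega a b : R).

(* The two carrier modes rotate at the speeds [shift0] and [speed1] that make the
   resonant part of the nonlinearity cancel exactly. *)
Definition shift0 : R := omega * reduced_coef (a ^ 2) b q 0.
Definition shift1 : R := omega * coef (laurent a b q) 1 / b.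
Definition speed1 : R := INR N ^ 2 + shift1.

(** The ansatz is [e^{i shift0 t} (a + b E)] with [E = e^{i ((speed1 - shift0) t + N x)}]; a term
    [c E^k] of its nonlinearity keeps the overall phase [shift0] and turns [k] times as fast as
    [E]. *)
Definition mode_atom (k : Z) (c : R) : atom :=
  (k, fun t => (RtoC c * cis ((shift0 + IZR k * (speed1 - shift0)) * t))%C).

Definition ansatz : list atom := [mode_atom 0 a; mode_atom 1 b].

Definition resonant : list atom :=
  [mode_atom 0 (coef (laurent a b q) 0); mode_atom 1 (coef (laurent a b q) 1)].

Definition nonresonant : list atom :=
  map (fun m => mode_atom (fst m) (snd m)) (filter (fun m => nonres (fst m)) (laurent a b q)).

Lemma acont_mode_atom k c : acont (mode_atom k c).
Proof.
  intros t; apply continuous_C_mult; [apply continuous_const|apply linear_cis_continuous].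
Qed.

Lemma acont_ansatz : Forall acont ansatz.
Proof. repeat constructor; apply acont_mode_atom. Qed.

Lemma acont_nonresonant : Forall acont nonresonant.
Proof. apply Forall_map, Forall_forall; intros; apply acont_mode_atom. Qed.

Lemma trig_eval_mode_atoms L t x :
  trig_eval N 0 (map (fun m => mode_atom (fst m) (snd m)) L) t x =
  (cis (shift0 * t) * laurent_eval L ((speed1 - shift0) * t + INR N * x))%C.
Proof.
  induction L as [|[k c] L IH]; cbn [map trig_eval mode_atom laurent_eval fst snd]; [ring|].
  rewrite IH; cbn [Cpow]; unfold freq.
  transitivity (RtoC c * (cis ((shift0 + IZR k * (speed1 - shift0)) * t) * cis (IZR k * INR N * x))
    + cis (shift0 * t) * laurent_eval L ((speed1 - shift0) * t + INR N * x))%C; [ring|].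
  transitivity (RtoC c * (cis (shift0 * t) * cis (IZR k * ((speed1 - shift0) * t + INR N * x)))
    + cis (shift0 * t) * laurent_eval L ((speed1 - shift0) * t + INR N * x))%C; [|ring].
  do 2 f_equal; rewrite <- !cis_plus; f_equal; ring.
Qed.

Lemma trig_eval_ansatz t x :
  trig_eval N 0 ansatz t x =
  (cis (shift0 * t) * (RtoC a + RtoC b * cis ((speed1 - shift0) * t + INR N * x)))%C.
Proof.
  pose proof (trig_eval_mode_atoms [(0%Z, a); (1%Z, b)] t x) as H.
  cbn [map fst snd] in H; fold ansatz in H; rewrite H; f_equal.
  cbn; rewrite Rmult_0_l, Rmult_1_l, cis_0; ring.
Qed.

(** Gauge covariance [F (e w) = e F (w)] for [|e| = 1] factors out the phase of the zero mode and
    leaves the Laurent expansion. *)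
Lemma resonance_split t x :
  (trig_eval N 0 resonant t x + trig_eval N 0 nonresonant t x)%C =
    nonlin q (trig_eval N 0 ansatz t x).
Proof.
  pose proof (trig_eval_mode_atoms [(0%Z, coef (laurent a b q) 0); (1%Z, coef (laurent a b q) 1)]
    t x) as H.
  cbn [map fst snd] in H; fold resonant in H; rewrite H; clear H.
  unfold nonresonant; rewrite trig_eval_mode_atoms, trig_eval_ansatz.
  set (y := (speed1 - shift0) * t + INR N * x).
  set (e := cis (shift0 * t)); set (w := (RtoC a + RtoC b * cis y)%C).
  assert (He : (e * Cconj e)%C = 1%C).
  { unfold e; rewrite <- cis_opp, <- cis_plus, Rplus_opp_r; apply cis_0. }
  transitivity (e * nonlin q w)%C.
  - unfold w; rewrite <- laurent_eval_nonlin, (laurent_eval_split (laurent a b q)).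
    cbn [laurent_eval]; rewrite Rmult_0_l, Rmult_1_l, cis_0; ring.
  - unfold nonlin.
    replace (e * w * Cconj (e * w))%C with (w * Cconj w)%C; [ring|].
    rewrite Cmult_conj.
    transitivity ((e * Cconj e) * (w * Cconj w))%C; [rewrite He; ring|ring].
Qed.

(** The hypothesis is the equation read off at one frequency: time frequency times amplitude on the
    left, dispersion plus source on the right. *)
Lemma mode_atom_derive (k : Z) (c f : R) i t x :
  c * (shift0 + IZR k * (speed1 - shift0)) = freq N k ^ 2 * c + omega * f ->
  is_derive_C (fun t => trig_eval N i [mode_atom k c] t x) t
   (- Ci * trig_eval N (S (S i)) [mode_atom k c] t x + RtoC omega * Ci * trig_eval N i [mode_atom
     k f] t x)%C.
Proof.
  intros Hf.
  set (m := shift0 + IZR k * (speed1 - shift0)) in *.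
  set (X := (RtoC (freq N k) * Ci)%C).
  pose proof (is_derive_C_mult (fun _ => X ^ i * RtoC c * cis (freq N k * x))%C (fun t => cis (m
    * t)) t _ _
    (is_derive_C_const _ t) (is_derive_cis m t)) as H.
  apply (is_derive_C_ext _ (fun t => trig_eval N i [mode_atom k c] t x)) in H.
  2: { intros s; cbn [trig_eval mode_atom]; fold m X; ring. }
  match type of H with is_derive_C _ _ ?l => match goal with |- is_derive_C _ _ ?l' =>
    replace l' with l; [exact H|] end end.
  cbn [trig_eval mode_atom Cpow]; fold m X.
  set (P := (X ^ i)%C); set (e := cis (freq N k * x)); set (e' := cis (m * t)).
  assert (HX : (X * X)%C = (- RtoC (freq N k ^ 2))%C)
    by (unfold X; apply injective_projections; cbn; ring).
  transitivity (P * Ci * e * e' * RtoC (c * m))%C; [rewrite RtoC_mult; ring|].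
  rewrite Hf, RtoC_plus, !RtoC_mult.
  transitivity (- Ci * (X * X) * P * RtoC c * e' * e + RtoC omega * Ci * P * RtoC f * e' * e)%C;
    [|ring].
  rewrite HX; ring.
Qed.

Lemma ansatz_derive i t x : b <> 0 ->
  is_derive_C (fun t => trig_eval N i ansatz t x) t
   (- Ci * trig_eval N (S (S i)) ansatz t x + RtoC omega * Ci * trig_eval N i resonant t x)%C.
Proof.
  intros Hb.
  pose proof (is_derive_C_plus _ _ t _ _
    (mode_atom_derive 0 a (coef (laurent a b q) 0) i t x
      ltac:(rewrite coef_laurent; change (Z.abs_nat (0 - 1)) with 1%nat; unfold shift0, freq; ring))
    (mode_atom_derive 1 b (coef (laurent a b q) 1) i t x
      ltac:(unfold speed1, shift1, freq; field; exact Hb))) as H.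
  eapply is_derive_C_ext with (g := fun t => trig_eval N i ansatz t x) in H.
  2: { intros s; cbv beta; rewrite <- trig_eval_app; reflexivity. }
  match type of H with is_derive_C _ _ ?l => match goal with |- is_derive_C _ _ ?l' =>
    replace l' with l; [exact H|] end end.
  unfold ansatz, resonant.
  change [mode_atom 0 a; mode_atom 1 b] with ([mode_atom 0 a] ++ [mode_atom 1 b]).
  change [mode_atom 0 (coef (laurent a b q) 0); mode_atom 1 (coef (laurent a b q) 1)]
    with ([mode_atom 0 (coef (laurent a b q) 0)] ++ [mode_atom 1 (coef (laurent a b q) 1)]).
  rewrite !trig_eval_app; ring.
Qed.

Fixpoint laurent_norm (L : list (Z * R)) : R :=
  match L with
  | [] => 0
  | (k, c) :: L' => Rabs c * weight k + laurent_norm L'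
  end.

Definition dispersion_gap : R := INR N ^ 2 / 2 - Rabs shift0 - Rabs shift1.

(** The detuning is [- N^2 (k^2 - k)] plus a combination of the shifts of size at most
    [(1 + |k|) (|shift0| + |shift1|)]. For [k] other than 0 and 1, [k^2 - k >= (1 + |k|) / 2], so
    the first term wins for all [k] at once; this is the origin of the division by 2 in
    [dispersion_gap]. *)
Lemma dispersion_bound (k : Z) : 0 < dispersion_gap -> nonres k = true ->
  dispersion_gap <= Rabs (shift0 + IZR k * (speed1 - shift0) - freq N k ^ 2).
Proof.
  intros HD Hk.
  unfold speed1, freq.
  set (r := IZR k).
  assert (Hr : r <= -1 \/ 2 <= r).
  { unfold nonres in Hk; unfold r.
    destruct (Z.eqb_spec k 0), (Z.eqb_spec k 1); try discriminate.
    destruct (Z_le_dec k (-1)); [left|right]; apply IZR_le; lia. }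
  assert (Hr2 : (1 + Rabs r) / 2 <= r ^ 2 - r).
  { destruct Hr; [rewrite Rabs_left by lra|rewrite Rabs_pos_eq by lra]; nra. }
  replace (shift0 + r * (INR N ^ 2 + shift1 - shift0) - (r * INR N) ^ 2)
    with (- (INR N ^ 2 * (r ^ 2 - r) + - ((1 - r) * shift0 + r * shift1))) by ring.
  rewrite Rabs_Ropp.
  assert (H1 : Rabs ((1 - r) * shift0 + r * shift1) <= (1 + Rabs r) * (Rabs shift0 + Rabs shift1)).
  { eapply Rle_trans; [apply Rabs_triang|]; rewrite !Rabs_mult.
    assert (Rabs (1 - r) <= 1 + Rabs r).
    { unfold Rminus; eapply Rle_trans; [apply Rabs_triang|]; rewrite Rabs_R1, Rabs_Ropp; lra. }
    pose proof (Rabs_pos shift0); pose proof (Rabs_pos shift1); pose proof (Rabs_pos r); nra. }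
  pose proof (pow2_ge_0 (INR N)) as HN.
  pose proof (Rabs_pos r).
  assert (H2 : INR N ^ 2 * ((1 + Rabs r) / 2) <= INR N ^ 2 * (r ^ 2 - r))
    by (apply Rmult_le_compat_l; assumption).
  eapply Rle_trans; [|apply Rle_abs].
  pose proof (Rle_abs ((1 - r) * shift0 + r * shift1)).
  apply Rle_trans with ((1 + Rabs r) * dispersion_gap); [nra|].
  unfold dispersion_gap; lra.
Qed.

(** The integrand is a pure exponential whose frequency is the detuning; its integral stays bounded
    by 2 over the detuning, uniformly in [t]. *)
Lemma duhamel_mode_atom_bound (k : Z) (c : R) t : Rabs omega = 1 -> 0 < dispersion_gap ->
  nonres k = true ->
  Cmod (snd (duhamel_atom N omega (mode_atom k c)) t) <= Rabs c * (2 / dispersion_gap).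
Proof.
  intros Ho HD Hk.
  pose proof (dispersion_bound k HD Hk) as Hb.
  set (m := shift0 + IZR k * (speed1 - shift0)) in *.
  unfold duhamel_atom, mode_atom; cbn [fst snd]; fold m.
  rewrite !Cmod_mult, Cmod_R, Ho, Cmod_Ci, Cmod_cis, !Rmult_1_l.
  set (n := m - freq N k ^ 2) in *.
  assert (Hn : n <> 0) by (intros E; rewrite E, Rabs_R0 in Hb; lra).
  replace (CInt (fun s => cis (- freq N k ^ 2 * s) * (RtoC c * cis (m * s)))%C t)
    with (RtoC c * CInt (fun s => cis (n * s)) t)%C.
  - rewrite Cmod_mult, Cmod_R; apply Rmult_le_compat_l; [apply Rabs_pos|].
    eapply Rle_trans; [now apply CInt_cis_bound|].
    apply Rmult_le_compat_l; [lra|apply Rinv_le_contravar; lra].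
  - assert (Hc : forall s, continuous_C (fun s => cis (n * s)) s) by apply linear_cis_continuous.
    assert (Hs : forall s, (cis (- freq N k ^ 2 * s) * (RtoC c * cis (m * s)))%C
        = (c * fst (cis (n * s)), c * snd (cis (n * s)))).
    { intros s.
      transitivity (RtoC c * (cis (- freq N k ^ 2 * s) * cis (m * s)))%C; [ring|].
      rewrite <- cis_plus.
      replace (- freq N k ^ 2 * s + m * s) with (n * s) by (unfold n; ring).
      apply injective_projections; cbn; ring. }
    unfold CInt.
    rewrite (RInt_ext (fun s => fst (cis (- freq N k ^ 2 * s) * (RtoC c * cis (m * s)))%C)
      (fun s => scal c (fst (cis (n * s))))) by (intros; rewrite Hs; reflexivity).
    rewrite (RInt_ext (fun s => snd (cis (- freq N k ^ 2 * s) * (RtoC c * cis (m * s)))%C)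
      (fun s => scal c (snd (cis (n * s))))) by (intros; rewrite Hs; reflexivity).
    rewrite (RInt_scal (V := R_CompleteNormedModule) (fun s => fst (cis (n * s)))),
      (RInt_scal (V := R_CompleteNormedModule) (fun s => snd (cis (n * s))));
    try (apply (ex_RInt_continuous (V := R_CompleteNormedModule)); intros; apply
      continuous_C_pair, Hc).
    set (I1 := RInt (fun s => fst (cis (n * s))) 0 t); set (I2 := RInt (fun s => snd (cis (n *
      s))) 0 t).
    change (scal c I1) with (c * I1); change (scal c I2) with (c * I2).
    apply injective_projections; cbn; ring.
Qed.

Lemma wnorm_duhamel_nonresonant t : Rabs omega = 1 -> 0 < dispersion_gap ->
  wnorm (duhamel N omega nonresonant) t <= laurent_norm (laurent a b q) * (2 / dispersion_gap).
Proof.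
  intros Ho HD.
  assert (0 < 2 / dispersion_gap) by (apply Rdiv_lt_0_compat; lra).
  unfold nonresonant; induction (laurent a b q) as [|[k c] L IH]; [cbn; lra|].
  cbn [filter laurent_norm fst].
  pose proof (weight_pos k); pose proof (Rabs_pos c).
  destruct (nonres k) eqn:Hk.
  - cbn [map duhamel wnorm]; unfold duhamel_atom at 1; cbn [fst snd].
    pose proof (duhamel_mode_atom_bound k c t Ho HD Hk) as Hb; cbn in Hb |- *.
    unfold duhamel in IH; nra.
  - assert (0 <= Rabs c * weight k) by nra; nra.
Qed.
End Ansatz.

(** * Fourier coefficients and conclusion *)

Lemma exists_nat_above (x : R) : exists n0 : nat, forall n, (n0 <= n)%nat -> x <= INR n.
Proof.
  destruct (nfloor_ex (Rmax 0 x) (Rmax_l 0 x)) as [n0 [_ Hn]].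
  exists (S n0); intros n Hle.
  apply le_INR in Hle; rewrite S_INR in Hle; pose proof (Rmax_r 0 x); lra.
Qed.

(** Stated for all large [N] so that two solutions can share one [N], which makes their data differ
    by a constant. The speed [beta] is left unspecified because the zero Fourier mode only sees the
    first term. *)
Lemma two_mode_solution (q : nat) (omega a b delta eta : R) :
  Rabs omega = 1 -> b <> 0 -> 0 < delta -> 0 < eta ->
  exists N0 : nat, forall N : nat, (N0 <= N)%nat ->
  exists (u : R -> R -> C) (beta : R),
    smooth_NLS_solution omega (2 * q + 1) delta u /\
    (forall x, u 0 x = (RtoC a + RtoC b * cis (INR N * x))%C) /\
    (forall t x, 0 <= t <= delta ->
      Cmod (u t x - (RtoC a * cis (shift0 q omega a b * t) + RtoC b * cis (beta * t) * cis (INR N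
        * x)))%C
      <= eta).
Proof.
  intros Ho Hb Hdelta Heta.
  set (T := delta + 1).
  set (R0 := Rabs a * weight 0 + Rabs b * weight 1).
  destruct (wnorm_nonlin_diff_bound q (R0 + 1)) as [L [HL HdF]].
  set (E := exp (2 * L * T)).
  assert (HE : 0 < E) by apply exp_pos.
  (* The bound [1/2] gives [2 eps E <= 1], which confines the iterates; [eta / 4] gives
     [4 eps E <= eta], the distance in [mode_close]. *)
  set (eps := Rmin (/ 2) (eta / 4) / E).
  assert (Hmin : 0 < Rmin (/ 2) (eta / 4)) by (apply Rmin_pos; lra).
  assert (Heps : 0 < eps) by now apply Rdiv_lt_0_compat.
  assert (HepsE : eps * E = Rmin (/ 2) (eta / 4)) by (unfold eps; field; lra).
  set (K := laurent_norm (laurent a b q)).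
  assert (HK : 0 <= K).
  { unfold K; induction (laurent a b q) as [|[k c] l IH]; cbn; [lra|].
    pose proof (weight_pos k); pose proof (Rabs_pos c); nra. }
  (* A gap above [2 K / eps] makes the first increment at most [eps]; the 1 keeps the gap
     positive. *)
  set (D0 := Rmax 1 (2 * K / eps)).
  set (sh0 := shift0 q omega a b); set (sh1 := shift1 q omega a b).
  (* The shifts do not depend on [N], and [N <= N^2] turns this linear condition into a lower bound
     for the gap. *)
  destruct (exists_nat_above (2 * (D0 + Rabs sh0 + Rabs sh1) + 1)) as [N0 HN0].
  exists N0; intros N HN; specialize (HN0 N HN).
  assert (HD0 : 1 <= D0) by apply Rmax_l.
  assert (HDK : 2 * K / eps <= D0) by apply Rmax_r.
  assert (HD : D0 <= dispersion_gap N q omega a b).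
  { unfold dispersion_gap; fold sh0 sh1.
    pose proof (Rabs_pos sh0); pose proof (Rabs_pos sh1).
    assert (INR N <= INR N ^ 2) by nra; lra. }
  set (z := ansatz N q omega a b); set (zr := resonant N q omega a b);
  set (zn := nonresonant N q omega a b).
  assert (Hz : Forall acont z) by apply acont_ansatz.
  assert (Hzn : Forall acont zn) by apply acont_nonresonant.
  assert (HzR : forall t, wnorm z t <= R0).
  { intros t; unfold z, ansatz, mode_atom; cbn [wnorm].
    rewrite !Cmod_mult, !Cmod_cis, !Cmod_R; unfold R0; lra. }
  assert (Hd0 : forall t, wnorm (duhamel N omega zn) t <= eps).
  { intros t; eapply Rle_trans; [apply wnorm_duhamel_nonresonant; [exact Ho|lra]|].
    fold K; set (D := dispersion_gap N q omega a b) in *.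
    assert (H : 2 * K <= eps * D).
    { apply Rle_trans with (eps * (2 * K / eps)); [right; field; lra|].
      apply Rmult_le_compat_l; lra. }
    apply Rmult_le_reg_r with D; [lra|].
    replace (K * (2 / D) * D) with (2 * K) by (field; lra); exact H. }
  assert (HR0 : 0 <= R0).
  { eapply Rle_trans; [apply (wnorm_pos z 0)|apply HzR]. }
  assert (HT : 0 < T) by (unfold T; lra).
  assert (Heps1 : 2 * (eps * exp (2 * L * T)) <= 1).
  { fold E; rewrite HepsE; pose proof (Rmin_l (/ 2) (eta / 4)); lra. }
  assert (Hzt : forall i t x, is_derive_C (fun t => trig_eval N i z t x) t
    (- Ci * trig_eval N (S (S i)) z t x + RtoC omega * Ci * trig_eval N i zr t x)%C).
  { intros; now apply ansatz_derive. }
  assert (Hsp : forall t x, (trig_eval N 0 zr t x + trig_eval N 0 zn t x)%C =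
    nonlin q (trig_eval N 0 z t x)).
  { intros; apply resonance_split. }
  assert (Hphase : forall t x, trig_eval N 0 z t x =
    (RtoC a * cis (sh0 * t) + RtoC b * cis (speed1 N q omega a b * t) * cis (INR N * x))%C).
  { intros t x; unfold z; rewrite trig_eval_ansatz; fold sh0.
    set (be := speed1 N q omega a b).
    transitivity (RtoC a * cis (sh0 * t) + RtoC b * (cis (sh0 * t) * cis ((be - sh0) * t + INR N
      * x)))%C;
      [ring|].
    rewrite <- Cmult_assoc, <- !cis_plus; do 3 f_equal; ring. }
  exists (mode N q omega z zn 0), (speed1 N q omega a b).
  split; [|split].
  - apply (evolution N q omega Ho z zr zn Hz Hzn Hzt Hsp T R0 L eps); auto; [lra|unfold T; lra].
  - intros x; rewrite mode_initial, Hphase, !Rmult_0_r, cis_0; ring.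
  - intros t x Ht; fold sh0; rewrite <- Hphase.
    eapply Rle_trans.
    + apply (mode_close N q omega Ho z zn Hz Hzn T R0 L eps); auto; [lra|].
      rewrite Rabs_pos_eq; unfold T; lra.
    + fold E; rewrite HepsE; pose proof (Rmin_r (/ 2) (eta / 4)); lra.
Qed.

(** * Fourier coefficients and Sobolev norms of two-mode functions *)

Definition cis_primitive (m : Z) (x : R) : C :=
  if Z.eq_dec m 0 then RtoC x else (- Ci * RtoC (/ IZR m) * cis (IZR m * x))%C.

Lemma cis_primitive_derive m x : is_derive_C (cis_primitive m) x (cis (IZR m * x)).
Proof.
  unfold cis_primitive; destruct (Z.eq_dec m 0) as [->|Hm].
  - rewrite Rmult_0_l, cis_0; apply is_derive_C_pair; cbn; split.
    + apply (is_derive_id (K := R_AbsRing)).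
    + apply (is_derive_const (K := R_AbsRing) (V := R_NormedModule)).
  - pose proof (is_derive_C_mult _ _ x _ _ (is_derive_C_const (- Ci * RtoC (/ IZR m))%C x)
      (is_derive_cis (IZR m) x)) as H; cbv beta in H.
    match type of H with is_derive_C _ _ ?l => replace (cis (IZR m * x)) with l; [exact H|] end.
    transitivity (- (Ci * Ci) * RtoC (/ IZR m * IZR m) * cis (IZR m * x))%C; [rewrite RtoC_mult;
      ring|].
    rewrite Rinv_l by now apply not_0_IZR.
    replace (Ci * Ci)%C with (- RtoC 1)%C by (apply injective_projections; cbn; ring); ring.
Qed.

Lemma cis_2PI_Z m : cis (IZR m * (2 * PI)) = 1%C.
Proof.
  (* Periodicity of the single exponential [e^{imx}], coded with [N = 1], compared at [0] and
     [2 PI]. *)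
  pose proof (trig_eval_periodic 1 0 [(m, fun _ => RtoC 1)] 0 0) as H; cbn in H.
  unfold freq in H; cbn in H; rewrite !Rmult_1_r, Rplus_0_l, Rmult_0_r, cis_0 in H.
  transitivity (1 * 1 * cis (IZR m * (2 * PI)) + 0)%C; [ring|]; rewrite H; ring.
Qed.

Lemma fourier_coeff_two_modes (A B : C) (N : nat) (n : Z) :
  fourier_coeff (fun x => A + B * cis (INR N * x))%C n =
  ((if Z.eq_dec n 0 then A else 0) + (if Z.eq_dec n (Z.of_nat N) then B else 0))%C.
Proof.
  set (df := fun x => (A * cis (IZR (- n) * x) + B * cis (IZR (Z.of_nat N - n) * x))%C).
  set (f := fun x => (A * cis_primitive (- n) x + B * cis_primitive (Z.of_nat N - n) x)%C).
  assert (Hd : forall x, is_derive_C f x (df x)).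
  { intros x; apply (is_derive_C_ext (fun x => A * cis_primitive (- n) x + B * cis_primitive
    (Z.of_nat N - n) x)%C);
      [reflexivity|].
    replace (df x) with ((0 * cis_primitive (- n) x + A * cis (IZR (- n) * x)) +
      (0 * cis_primitive (Z.of_nat N - n) x + B * cis (IZR (Z.of_nat N - n) * x)))%C by (unfold
        df; ring).
    apply is_derive_C_plus; apply (is_derive_C_mult (fun _ => _));
      auto using is_derive_C_const, cis_primitive_derive. }
  assert (Hc : forall x, continuous_C df x).
  { intros x; apply continuous_C_plus; apply continuous_C_mult;
      auto using linear_cis_continuous; apply continuous_const. }
  pose proof (is_RInt_derive (V := C_R_CompleteNormedModule) f df 0 (2 * PI)
     (fun x _ => Hd x) (fun x _ => Hc x)) as HI.
  unfold fourier_coeff.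
  rewrite (RInt_ext (V := C_R_CompleteNormedModule) _ df).
  2: { intros x _; unfold df.
       replace (cos (IZR n * x), - sin (IZR n * x))%R with (cis (IZR (- n) * x)).
       - match goal with |- ?l = ?r => change (@eq C l r) end.
         transitivity (A * cis (IZR (- n) * x) + B * (cis (INR N * x) * cis (IZR (- n) * x)))%C;
           [ring|]; rewrite <- cis_plus; do 3 f_equal.
         rewrite minus_IZR, opp_IZR, INR_IZR_INZ; ring.
       - unfold cis; rewrite opp_IZR, <- cos_neg, <- sin_neg; do 2 f_equal; ring. }
  rewrite (is_RInt_unique (V := C_R_CompleteNormedModule) _ _ _ _ HI).
  assert (HP : forall m, (cis_primitive m (2 * PI) - cis_primitive m 0)%C =
     if Z.eq_dec m 0 then RtoC (2 * PI) else 0%C).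
  { intros m; unfold cis_primitive; destruct (Z.eq_dec m 0) as [Hm|Hm]; [ring|].
    rewrite cis_2PI_Z, Rmult_0_r, cis_0; ring. }
  change (minus (f (2 * PI)) (f 0)) with (f (2 * PI)%R - f 0%R)%C.
  replace (f (2 * PI)%R - f 0%R)%C with (RtoC (2 * PI) * ((if Z.eq_dec n 0 then A else 0) +
    (if Z.eq_dec n (Z.of_nat N) then B else 0)))%C.
  - set (S := ((if Z.eq_dec n 0 then A else 0) + (if Z.eq_dec n (Z.of_nat N) then B else 0))%C).
    pose proof PI_RGT_0.
    apply injective_projections; cbn; unfold scal; cbn; unfold mult; cbn; field; lra.
  - transitivity (A * (cis_primitive (- n) (2 * PI) - cis_primitive (- n) 0) +
      B * (cis_primitive (Z.of_nat N - n) (2 * PI) - cis_primitive (Z.of_nat N - n) 0))%C;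
      [|unfold f; ring].
    rewrite !HP.
    destruct (Z.eq_dec n 0), (Z.eq_dec n (Z.of_nat N)), (Z.eq_dec (- n) 0),
      (Z.eq_dec (Z.of_nat N - n) 0); try lia; ring.
Qed.

Lemma fourier_coeff_ext (f g : R -> C) n : (forall x, f x = g x) -> fourier_coeff f n =
  fourier_coeff g n.
Proof.
  intros H; unfold fourier_coeff; f_equal.
  apply (RInt_ext (V := C_R_CompleteNormedModule)); intros x _; now rewrite H.
Qed.

Lemma fourier_coeff_0_close (f g : R -> C) (eta : R) :
  (forall x, continuous_C f x) -> (forall x, continuous_C g x) ->
  (forall x, Cmod (f x - g x)%C <= eta) ->
  Cmod (fourier_coeff f 0 - fourier_coeff g 0)%C <= eta.
Proof.
  intros Hf Hg Hfg.
  set (w := fun h : R -> C => fun x => (h x * (cos (0 * x), - sin (0 * x))%R)%C).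
  assert (Hw : forall h, (forall x, continuous_C h x) ->
    is_RInt (V := C_R_CompleteNormedModule) (w h) 0 (2 * PI)
      (RInt (V := C_R_CompleteNormedModule) (w h) 0 (2 * PI))).
  { intros h Hh; apply (RInt_correct (V := C_R_CompleteNormedModule)).
    apply (ex_RInt_continuous (V := C_R_CompleteNormedModule)); intros x _.
    apply continuous_C_mult; [apply Hh|].
    apply continuous_C_pair; cbn; split.
    - apply (ex_derive_continuous (K := R_AbsRing) (V := R_NormedModule)); auto_derive; trivial.
    - apply (ex_derive_continuous (K := R_AbsRing) (V := R_NormedModule)); auto_derive; trivial. }
  pose proof PI_RGT_0 as HPI.
  pose proof (is_RInt_minus (V := CR) _ _ _ _ _ _ (Hw f Hf) (Hw g Hg)) as H.
  assert (Hb : forall x, 0 <= x <= 2 * PI -> norm (V := CR) (minus (w f x) (w g x)) <= eta).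
  { intros x _.
    eapply Rle_trans; [right; symmetry; exact (Cmod_norm (w f x - w g x)%C)|].
    replace (w f x - w g x)%C with ((f x - g x) * cis (- (0 * x)))%C.
    - rewrite Cmod_mult, Cmod_cis, Rmult_1_r; apply Hfg.
    - rewrite cis_opp; unfold w; unfold cis, Cconj; cbn [fst snd]; ring. }
  assert (HPI2 : 0 <= 2 * PI) by lra.
  pose proof (norm_RInt_le_const (V := CR) _ _ _ _ eta HPI2 Hb H) as H2.
  unfold fourier_coeff; fold (w f); fold (w g).
  set (I1 := RInt (V := C_R_CompleteNormedModule) (w f) 0 (2 * PI)) in *.
  set (I2 := RInt (V := C_R_CompleteNormedModule) (w g) 0 (2 * PI)) in *.
  assert (H3 : Cmod (I1 - I2)%C <= (2 * PI - 0) * eta).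
  { eapply Rle_trans; [right; exact (Cmod_norm (I1 - I2)%C)|exact H2]. }
  replace (scal (V := CR) (/ (2 * PI))%R I1 - scal (V := CR) (/ (2 * PI))%R I2)%C
    with (RtoC (/ (2 * PI)) * (I1 - I2))%C.
  - rewrite Cmod_mult, Cmod_R, Rabs_pos_eq by (left; apply Rinv_0_lt_compat; lra).
    apply Rmult_le_reg_l with (2 * PI); [lra|].
    rewrite <- Rmult_assoc, Rinv_r, Rmult_1_l by lra; lra.
  - apply injective_projections; cbn; unfold scal; cbn; unfold mult; cbn; ring.
Qed.

Lemma sum_n_single (X : R) (j n : nat) : (j <= n)%nat ->
  sum_n (fun k => if Nat.eq_dec k j then X else 0) n = X.
Proof.
  intros Hj.
  assert (H : forall m, sum_n (fun k => if Nat.eq_dec k j then X else 0) m =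
     if le_dec j m then X else 0).
  { induction m as [|m IH].
    - rewrite sum_O; destruct (Nat.eq_dec 0 j), (le_dec j 0); try lia; reflexivity.
    - rewrite sum_Sn, IH.
      match goal with |- plus ?x ?y = ?z => change (x + y = z) end.
      destruct (Nat.eq_dec (S m) j), (le_dec j m), (le_dec j (S m)); try lia; ring. }
  rewrite H; destruct (le_dec j n); [reflexivity|lia].
Qed.

Lemma Hs_norm_two_modes (s a b : R) (N : nat) (f : R -> C) :
  (0 < N)%nat -> 0 <= a -> 0 <= b -> (forall x, f x = (RtoC a + RtoC b * cis (INR N * x))%C) ->
  exists r, Hs_norm s f = Finite r /\ r <= a + b * Rpower (1 + INR N) s.
Proof.
  intros HN Ha Hb Hf.
  set (P := Rpower (1 + INR N) s).
  assert (HP : 0 < P) by apply exp_pos.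
  set (S0 := a ^ 2 + P ^ 2 * b ^ 2).
  exists (sqrt S0); split.
  - unfold Hs_norm, sum_Z.
    replace (Lim_seq _) with (Finite S0); [reflexivity|symmetry].
    apply is_lim_seq_unique.
    apply is_lim_seq_ext_loc with (fun _ => S0); [|apply is_lim_seq_const].
    (* The term of index [k] has frequency [k - M], so the two modes sit at [k = M] and [k = M + N];
       both lie in the range [k <= 2 M] once [M >= N], and the partial sums are constant from there
       on. *)
    exists N; intros M HM; symmetry.
    rewrite (sum_n_ext _ (fun k => plus (if Nat.eq_dec k M then a ^ 2 else 0)
      (if Nat.eq_dec k (M + N) then P ^ 2 * b ^ 2 else 0))).
    + rewrite sum_n_plus, !sum_n_single by lia; reflexivity.
    + intros k.
      rewrite (fourier_coeff_ext f _ _ Hf), fourier_coeff_two_modes.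
      unfold plus; cbn [AbelianMonoid.plus]; cbn -[pow].
      destruct (Z.eq_dec (Z.of_nat k - Z.of_nat M) 0) as [E|E], (Nat.eq_dec k M),
        (Z.eq_dec (Z.of_nat k - Z.of_nat M) (Z.of_nat N)) as [E'|E'], (Nat.eq_dec k (M + N)); try
          lia.
      * rewrite E, Rabs_R0, Rplus_0_r, Cplus_0_r, Cmod_R, Rabs_pos_eq by exact Ha.
        unfold Rpower; rewrite ln_1, Rmult_0_r, exp_0; ring.
      * rewrite E', <- INR_IZR_INZ, (Rabs_pos_eq (INR N)) by apply pos_INR.
        rewrite Cplus_0_l, Cmod_R, Rabs_pos_eq by exact Hb.
        unfold P; replace (2 * s) with (s + s) by ring; rewrite Rpower_plus; ring.
      * rewrite Cplus_0_l, Cmod_0; ring.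
  - apply Rsqr_incr_0_var; [|nra].
    rewrite Rsqr_sqrt; unfold Rsqr, S0; [|nra].
    assert (0 <= b * P) by (apply Rmult_le_pos; lra); nra.
Qed.

Lemma Rpower_neg_small (s b rho : R) : s < 0 -> 0 < b -> 0 < rho ->
  exists N0 : nat, forall N, (N0 <= N)%nat -> b * Rpower (1 + INR N) s <= rho.
Proof.
  intros Hs Hb Hr.
  (* The threshold is [(rho / b)^(1 / s)], the point where [b X^s = rho]. *)
  destruct (exists_nat_above (exp (ln (rho / b) / s))) as [N0 HN0].
  exists N0; intros N HN; specialize (HN0 N HN).
  pose proof (exp_pos (ln (rho / b) / s)).
  assert (Hrb : 0 < rho / b) by now apply Rdiv_lt_0_compat.
  assert (Hln : ln (rho / b) / s < ln (1 + INR N)).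
  { rewrite <- (ln_exp (ln (rho / b) / s)) at 1; apply ln_increasing; lra. }
  apply Rle_trans with (b * (rho / b)); [|right; field; lra].
  apply Rmult_le_compat_l; [lra|].
  rewrite <- (exp_ln (rho / b)) by exact Hrb.
  unfold Rpower; left; apply exp_increasing.
  apply Rmult_lt_compat_r with (r := - s) in Hln; [|lra].
  replace (ln (rho / b) / s * - s) with (- ln (rho / b)) in Hln by (field; lra).
  lra.
Qed.

Lemma smooth_NLS_solution_continuous omega p delta u t x :
  smooth_NLS_solution omega p delta u -> 0 <= t <= delta -> continuous_C (u t) x.
Proof.
  intros [_ [D [[HD0 [_ [HDx _]]] _]]] Ht.
  apply (is_derive_C_continuous (u t) x (D 0%nat 1%nat t x)).
  apply (is_derive_C_ext (fun x => D 0%nat 0%nat t x)); [intros; now apply HD0|now apply HDx].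
Qed.

Theorem theorem2 (s : R) (hs : s < 0) :
  exists c : R, 0 < c /\
  forall (omega : R) (p : nat),
    (omega = 1 \/ omega = -1) -> Nat.Odd p -> (5 <= p)%nat ->
  forall rho delta : R, 0 < rho -> 0 < delta ->
  exists u1 u2 : R -> R -> C,
    smooth_NLS_solution omega p delta u1 /\
    smooth_NLS_solution omega p delta u2 /\
    (exists a : C, Cmod a <= delta /\ forall x : R, (u1 0 x - u2 0 x)%C = a) /\
    Rbar_le (Rbar_plus (Hs_norm s (u1 0)) (Hs_norm s (u2 0))) (Finite rho) /\
    Rbar_le (Finite (c * rho))
      (Lub_Rbar (fun r : R => exists t : R, 0 <= t <= delta /\
         r = Cmod (fourier_coeff (u1 t) 0 - fourier_coeff (u2 t) 0)%C)).
Proof.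
  (* The zero modes will be at least [rho / 4] apart for the two ansatz functions, and each
     approximation costs [rho / 16]. *)
  exists (/ 8); split; [lra|].
  intros omega p Homega [q Hq] Hp rho delta Hrho Hdelta; subst p.
  assert (Ho : Rabs omega = 1).
  { destruct Homega as [-> | ->]; [apply Rabs_R1|rewrite Rabs_left; lra]. }
  (* The difference of the data: [delta] is its allowed size, and [rho / 8] keeps the norm budget,
     [a1 + a2 + 2 (rho / 8) <= rho]. *)
  set (h := Rmin delta (rho / 8)).
  assert (Hh : 0 < h) by (apply Rmin_pos; lra).
  assert (Hhd : h <= delta) by apply Rmin_l.
  assert (Hhr : h <= rho / 8) by apply Rmin_r.
  set (a2 := rho / 8); set (a1 := a2 + h).
  assert (HA : 0 <= a2 ^ 2 <= a1 ^ 2) by (unfold a1, a2; nra).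
  assert (HA' : 0 < a1 ^ 2 - a2 ^ 2) by (unfold a1, a2; nra).
  (* Through [reduced_coef_gap] this yields a difference of rotation speeds of at least
     [PI / delta]. *)
  set (b := Rmax 1 (PI / (delta * (a1 ^ 2 - a2 ^ 2)))).
  assert (Hb : 1 <= b) by apply Rmax_l.
  pose proof PI_RGT_0 as HPI.
  set (G := reduced_coef (a1 ^ 2) b q 0 - reduced_coef (a2 ^ 2) b q 0).
  assert (HG : PI / delta <= G).
  { eapply Rle_trans; [|apply (reduced_coef_gap _ _ b q HA Hb); lia].
    apply Rle_trans with ((a1 ^ 2 - a2 ^ 2) * (PI / (delta * (a1 ^ 2 - a2 ^ 2)))).
    - right; field; lra.
    - apply Rmult_le_compat_l; [lra|apply Rmax_r]. }
  assert (HPd : 0 < PI / delta) by now apply Rdiv_lt_0_compat.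
  destruct (two_mode_solution q omega a1 b delta (rho / 16) Ho) as [N1 HN1]; try lra.
  destruct (two_mode_solution q omega a2 b delta (rho / 16) Ho) as [N2 HN2]; try lra.
  destruct (Rpower_neg_small s b (rho / 8) hs) as [N3 HN3]; try lra.
  set (N := S (N1 + N2 + N3)).
  destruct (HN1 N) as [u1 [beta1 [Hs1 [Hi1 Hc1]]]]; [lia|].
  destruct (HN2 N) as [u2 [beta2 [Hs2 [Hi2 Hc2]]]]; [lia|].
  specialize (HN3 N ltac:(lia)).
  exists u1, u2; split; [exact Hs1|]; split; [exact Hs2|]; split; [|split].
  - exists (RtoC h); split.
    + rewrite Cmod_R, Rabs_pos_eq; lra.
    + intros x; rewrite Hi1, Hi2; unfold a1; rewrite RtoC_plus; ring.
  - destruct (Hs_norm_two_modes s a1 b N (u1 0)) as [r1 [-> Hr1]];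
      [lia|unfold a1, a2; lra|lra|exact Hi1|].
    destruct (Hs_norm_two_modes s a2 b N (u2 0)) as [r2 [-> Hr2]];
      [lia|unfold a2; lra|lra|exact Hi2|].
    cbn; unfold a1, a2 in *; lra.
  (* The instant at which the relative phase of the two zero modes has reached half a turn; it is at
     most [delta] because [G >= PI / delta]. *)
  - set (t := PI / G).
    assert (Ht : 0 <= t <= delta).
    { unfold t; split; [left; apply Rdiv_lt_0_compat; lra|].
      apply Rmult_le_reg_r with G; [lra|].
      replace (PI / G * G) with (PI / delta * delta) by (field; lra).
      rewrite (Rmult_comm delta); apply Rmult_le_compat_r; lra. }
    set (r := Cmod (fourier_coeff (u1 t) 0 - fourier_coeff (u2 t) 0)%C).
    apply Rbar_le_trans with (Finite r).
    2: { apply Lub_Rbar_correct; exists t; split; [exact Ht|reflexivity]. }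
    cbn.
    assert (HF : forall u a beta, smooth_NLS_solution omega (2 * q + 1) delta u ->
      (forall x, Cmod (u t x - (RtoC a * cis (shift0 q omega a b * t) +
         RtoC b * cis (beta * t) * cis (INR N * x)))%C <= rho / 16) ->
      Cmod (fourier_coeff (u t) 0 - RtoC a * cis (shift0 q omega a b * t))%C <= rho / 16).
    { intros u a beta Hu Hc.
      set (A := (RtoC a * cis (shift0 q omega a b * t))%C) in *.
      set (B := (RtoC b * cis (beta * t))%C) in *.
      replace A with (fourier_coeff (fun x => A + B * cis (INR N * x))%C 0).
      - apply fourier_coeff_0_close; [| |exact Hc].
        + intros x; eapply smooth_NLS_solution_continuous; eassumption.
        + intros x; apply continuous_C_plus; [apply continuous_const|].
          apply continuous_C_mult; [apply continuous_const|apply linear_cis_continuous].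
      - rewrite fourier_coeff_two_modes.
        destruct (Z.eq_dec 0 0), (Z.eq_dec 0 (Z.of_nat N)); try lia; ring. }
    pose proof (HF u1 a1 beta1 Hs1 (fun x => Hc1 t x Ht)) as F1.
    pose proof (HF u2 a2 beta2 Hs2 (fun x => Hc2 t x Ht)) as F2.
    (* The phases differ by [omega PI], and half a turn in either direction is multiplication by
       -1. *)
    assert (Hphase : cis (shift0 q omega a1 b * t) = (- cis (shift0 q omega a2 b * t))%C).
    { replace (shift0 q omega a1 b * t) with (shift0 q omega a2 b * t + omega * PI).
      - rewrite cis_plus.
        replace (cis (omega * PI)) with (- RtoC 1)%C; [ring|].
        destruct Homega as [-> | ->]; unfold cis.
        + rewrite Rmult_1_l, cos_PI, sin_PI; apply injective_projections; cbn; ring.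
        + replace (-1 * PI) with (- PI) by ring.
          rewrite cos_neg, sin_neg, cos_PI, sin_PI; apply injective_projections; cbn; ring.
      - unfold shift0, t, G; fold G.
        apply Rminus_diag_uniq.
        transitivity (omega * (PI - G * (PI / G))); [unfold G; ring|field; lra]. }
    rewrite Hphase in F1.
    set (e := cis (shift0 q omega a2 b * t)) in *.
    set (c1 := fourier_coeff (u1 t) 0) in *; set (c2 := fourier_coeff (u2 t) 0) in *.
    (* In phase opposition the amplitudes add: [- a1 e] and [a2 e] are at distance [a1 + a2],
       although [a1 - a2] may be tiny. *)
    assert (Htri : a1 + a2 <= Cmod (c1 - RtoC a1 * - e)%C + Cmod (c1 - c2)%C + Cmod (c2 - RtoC a2
      * e)%C).
    { replace (a1 + a2) with (Cmod (RtoC (a1 + a2) * e)%C).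
      2: { rewrite Cmod_mult, Cmod_R; unfold e; rewrite Cmod_cis, Rmult_1_r.
           apply Rabs_pos_eq; unfold a1, a2; lra. }
      replace (RtoC (a1 + a2) * e)%C
        with ((c1 - RtoC a1 * - e) + (- (c1 - c2) + - (c2 - RtoC a2 * e)))%C
        by (rewrite RtoC_plus; ring).
      eapply Rle_trans; [apply Cmod_triangle|].
      rewrite Rplus_assoc; apply Rplus_le_compat_l.
      eapply Rle_trans; [apply Cmod_triangle|]; rewrite !Cmod_opp; lra. }
    assert (Ha : rho / 4 <= a1 + a2) by (unfold a1, a2; lra).
    fold r in Htri; lra.
Qed.
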